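(* Let $k$ be a commutative associative unital ring, $A$ a separable associative unital $k$-algebra, and assume: (i) $A$ is perfect and finitely presented as a $k$-module; (ii) $R$ is a commutative associative unital $k$-algebra which is flat over $k$; (iii) $S$ is a commutative associative unital $R$-algebra which is étale and faithfully flat over $R$; (iv) $B\subset A_S=A\otimes_kS$ is an $(S/R)$-form of $A\otimes_kR$, i.e. an $R$-subalgebra such that $B\otimes_RS\to A_S$, $b\otimes s\mapsto sb$, is an isomorphism of $S$-algebras; (v) $N$ is a $B$-bimodule over $R$ (an associative bimodule over the $R$-algebra $B$ on which the left and right actions of $R$ agree); (vi) there is an $R$-linear map $\pi:N_S=N\otimes_RS\to N$ with $\pi(b\cdot m)=b\cdot\pi(m)$ and $\pi(m\cdot b)=\pi(m)\cdot b$ for all $b\in B$, $m\in N_S$. Then all $R$-linear derivations $B\to N$ are inner, i.e. $\operatorname{Der}_R(B,N)=\operatorname{IDer}(B,N)$, and so the first Hochschild cohomology group of the associative $k$-algebra $B$ with values in $N$ is $$HH^1(B,N)\simeq\operatorname{Der}_k\big(R,\operatorname{Ctd}_k(B,N)\big).$$ For example, for $N=B$ one has $\operatorname{Ctd}_k(B,B)=Z(B)$, the centre of $B$, and therefore $HH^1(B)\simeq\operatorname{Der}_k(R,Z(B))$; in particular, if $B$ is a central $R$-algebra, then $HH^1(B)\simeq\operatorname{Der}_k(R)$.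
   Context: An algebra is perfect if it is spanned additively by products $a_1a_2$. For a $k$-algebra $B$ and a $B$-bimodule $N$, $\operatorname{Der}_k(B,N)$ is the $k$-module of $k$-linear maps $d:B\to N$ with $d(b_1b_2)=d(b_1)\cdot b_2+b_1\cdot d(b_2)$, $\operatorname{Der}_R(B,N)$ is the submodule of $R$-linear ones, and $HH^1(B,N)=\operatorname{Der}_k(B,N)/\operatorname{IDer}(B,N)$, where $\operatorname{IDer}(B,N)$ consists of the maps $b\mapsto b\cdot n-n\cdot b$, $n\in N$; $HH^1(B)=HH^1(B,B)$. The centroid with values in $N$ is $\operatorname{Ctd}_k(B,N)=\{\chi\in\operatorname{Hom}_k(B,N):\chi(b_1b_2)=\chi(b_1)\cdot b_2=b_1\cdot\chi(b_2)\ \forall b_1,b_2\in B\}$; it is an $R$-bimodule via $(r\cdot\chi)(b)=r\chi(b)$, $(\chi\cdot r)(b)=\chi(rb)$ (the two structures coincide since $B$ is perfect). $\operatorname{Der}_k(R,P)$ denotes the $k$-linear derivations of $R$ with values in the $R$-bimodule $P$, and $\operatorname{Der}_k(R)=\operatorname{Der}_k(R,R)$. The actions of $B$ on $N_S$ are $b\cdot(n\otimes s)=(b\cdot n)\otimes s$, $(n\otimes s)\cdot b=(n\cdot b)\otimes s$. $B$ is a central $R$-algebra if the map $R\to\operatorname{Ctd}_R(B,B)$, $r\mapsto(b\mapsto rb)$, is an isomorphism (equivalently here, $R\simeq Z(B)$). *)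

(* Defs.v *)
From HB Require Import structures.
From mathcomp Require Import all_boot all_algebra.
From mathcomp Require Import boolp functions.
Set Implicit Arguments.
Unset Strict Implicit.
Unset Printing Implicit Defensive.
Import GRing.Theory.
Local Open Scope ring_scope.
Local Open Scope quotient_scope.

Definition lmod_iso (k : pzRingType) (V W : lmodType k) : Prop :=
  exists phi : {linear V -> W}, bijective phi.

(* Exactness at Y; it includes v o u = 0. *)
Definition exact (k : pzRingType) (X Y Z : lmodType k)
    (u : {linear X -> Y}) (v : {linear Y -> Z}) : Prop :=
  forall y, v y = 0 <-> exists x, u x = y.

Definition fp_module (k : pzRingType) (M : lmodType k) : Prop :=
  exists (m n : nat) (u : {linear 'rV[k]_m -> 'rV[k]_n})
    (p : {linear 'rV[k]_n -> M}),
    exact u p /\ (forall x, exists y, p y = x).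

Definition projective (E : pzRingType) (P : lmodType E) : Prop :=
  forall (X Y : lmodType E) (p : {linear X -> Y}) (h : {linear P -> Y}),
    (forall y, exists x, p x = y) ->
  exists l : {linear P -> X}, forall x, p (l x) = h x.

Section QuotientModule.
Variables (k : pzRingType) (V : lmodType k) (U : {pred V}).
Hypothesis U_closed : submod_closed U.

Definition lquot_pred of submod_closed U : {pred V} := U.
HB.instance Definition _ :=
  GRing.isSubmodClosed.Build k V (lquot_pred U_closed)
    (GRing.submod_closed_semi U_closed).
Local Notation U' := (lquot_pred U_closed).

Definition lquot : Type := Quotient.quot U'.
HB.instance Definition _ := GRing.Zmodule.on lquot.

Definition lquot_pi (v : V) : lquot := \pi_(Quotient.quot U') v.

Lemma lquot_piP v w : reflect (lquot_pi v = lquot_pi w) (v - w \in U').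
Proof. by rewrite Quotient.idealrBE; apply: eqP. Qed.

Lemma lquot_piD v w : lquot_pi (v + w) = lquot_pi v + lquot_pi w.
Proof. exact: Quotient.pi_add. Qed.

Lemma lquot_piK (x : lquot) : lquot_pi (repr (x : (Quotient.quot U'))) = x.
Proof. exact: reprK. Qed.

Definition lquot_scale (a : k) (x : lquot) : lquot :=
  lquot_pi (a *: repr (x : (Quotient.quot U'))).

Lemma lquot_scaleE a v : lquot_scale a (lquot_pi v) = lquot_pi (a *: v).
Proof.
apply/lquot_piP; rewrite -scalerBr rpredZ //; apply/lquot_piP.
exact: lquot_piK.
Qed.

Fact lquot_scalerA a b x :
  lquot_scale a (lquot_scale b x) = lquot_scale (a * b) x.
Proof. by rewrite -[x]lquot_piK !lquot_scaleE scalerA. Qed.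
Fact lquot_scale1r : left_id 1 lquot_scale.
Proof. by move=> x; rewrite -[x]lquot_piK lquot_scaleE scale1r. Qed.
Fact lquot_scalerDr : right_distributive lquot_scale +%R.
Proof.
move=> a x y; rewrite -[x]lquot_piK -[y]lquot_piK.
by rewrite -lquot_piD !lquot_scaleE scalerDr lquot_piD.
Qed.
Fact lquot_scalerDl x : {morph lquot_scale^~ x : a b / a + b}.
Proof.
by move=> a b; rewrite -[x]lquot_piK !lquot_scaleE scalerDl lquot_piD.
Qed.
HB.instance Definition _ := GRing.Zmodule_isLmodule.Build k lquot
  lquot_scalerA lquot_scale1r lquot_scalerDr lquot_scalerDl.
End QuotientModule.

Definition restr (k R : pzRingType) (f : {rmorphism k -> R}) (M : lmodType R) :
  Type := M.

Section Restriction.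
Variables (k R : pzRingType) (f : {rmorphism k -> R}) (M : lmodType R).
HB.instance Definition _ := GRing.Zmodule.on (restr f M).
Definition restr_scale (a : k) (m : restr f M) : restr f M := f a *: (m : M).
Fact restr_scalerA a b m :
  restr_scale a (restr_scale b m) = restr_scale (a * b) m.
Proof. by rewrite /restr_scale scalerA rmorphM. Qed.
Fact restr_scale1r : left_id 1 restr_scale.
Proof. by move=> m; rewrite /restr_scale rmorph1 scale1r. Qed.
Fact restr_scalerDr : right_distributive restr_scale +%R.
Proof. by move=> a m n; exact: scalerDr. Qed.
Fact restr_scalerDl m : {morph restr_scale^~ m : a b / a + b}.
Proof. by move=> a b; rewrite /restr_scale rmorphD scalerDl. Qed.
HB.instance Definition _ := GRing.Zmodule_isLmodule.Build k (restr f M)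
  restr_scalerA restr_scale1r restr_scalerDr restr_scalerDl.
End Restriction.

(* The elements of the tensor product of M and N are the finite formal sums  *)
(* of pairs (m, n), modulo the smallest congruence making (m, n) bilinear.   *)
Section Tensor.
Variables (k : comPzRingType) (M N : lmodType k).
Local Notation formal_sum := (seq (M * N)).

Inductive tens_eq : formal_sum -> formal_sum -> Prop :=
| TensRefl s : tens_eq s s
| TensSym s t : tens_eq s t -> tens_eq t s
| TensTrans s t u : tens_eq s t -> tens_eq t u -> tens_eq s u
| TensCat s s' t t' :
    tens_eq s s' -> tens_eq t t' -> tens_eq (s ++ t) (s' ++ t')
| TensCatC s t : tens_eq (s ++ t) (t ++ s)
| TensZero n : tens_eq [:: (0, n)] [::]
| TensDl m m' n : tens_eq [:: (m + m', n)] [:: (m, n); (m', n)]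
| TensDr m n n' : tens_eq [:: (m, n + n')] [:: (m, n); (m, n')]
| TensZ (a : k) m n : tens_eq [:: (a *: m, n)] [:: (m, a *: n)].

Definition tens_rel (s t : formal_sum) : bool := `[< tens_eq s t >].

Lemma tens_rel_equiv : equiv_class_of tens_rel.
Proof.
split=> [s|s t|t s u].
- exact/asboolP/TensRefl.
- by apply/asboolP/asboolP; exact: TensSym.
- by move=> /asboolP st /asboolP tu; apply/asboolP/(TensTrans st tu).
Qed.
Canonical tens_equiv := EquivRelPack tens_rel_equiv.
Canonical tens_encModRel := defaultEncModRel tens_rel.

Definition tens : Type := {eq_quot tens_rel}.
HB.instance Definition _ := Choice.on tens.

Definition tens_pi (s : formal_sum) : tens := \pi_({eq_quot tens_rel}) s.
Definition tens_repr (x : tens) : formal_sum := repr (x : {eq_quot tens_rel}).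

Lemma tens_piP s t : tens_pi s = tens_pi t <-> tens_eq s t.
Proof.
split; first by move/eqP; rewrite eqmodE => /asboolP.
by move=> st; apply/eqP; rewrite eqmodE; apply/asboolP.
Qed.

Lemma tens_reprK x : tens_pi (tens_repr x) = x. Proof. exact: reprK. Qed.

Lemma tens_repr_pi s : tens_eq (tens_repr (tens_pi s)) s.
Proof. by apply/tens_piP; exact: tens_reprK. Qed.

Definition tn (m : M) (n : N) : tens := tens_pi [:: (m, n)].

Definition tens_add (x y : tens) := tens_pi (tens_repr x ++ tens_repr y).
Definition tens_scale (a : k) (x : tens) :=
  tens_pi [seq (a *: p.1, p.2) | p <- tens_repr x].

Lemma tens_addE s t : tens_add (tens_pi s) (tens_pi t) = tens_pi (s ++ t).
Proof. by apply/tens_piP/TensCat; exact: tens_repr_pi. Qed.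

Lemma tens_eq_scale a s t : tens_eq s t ->
  tens_eq [seq (a *: p.1, p.2) | p <- s] [seq (a *: p.1, p.2) | p <- t].
Proof.
elim=> {s t} [s|s t _|s t u _ + _|s s' t t' _ ss _ tt|s t|n|m m' n|m n n'|b m n]
  /=.
- exact: TensRefl.
- exact: TensSym.
- exact: TensTrans.
- by rewrite !map_cat; exact: TensCat.
- by rewrite !map_cat; exact: TensCatC.
- by rewrite scaler0; exact: TensZero.
- by rewrite scalerDr; exact: TensDl.
- exact: TensDr.
- by rewrite scalerA mulrC -scalerA; exact: TensZ.
Qed.

Lemma tens_scaleE a s :
  tens_scale a (tens_pi s) = tens_pi [seq (a *: p.1, p.2) | p <- s].
Proof. by apply/tens_piP/tens_eq_scale/tens_repr_pi. Qed.

Fact tens_addA : associative tens_add.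
Proof.
move=> x y z; rewrite -[x]tens_reprK -[y]tens_reprK -[z]tens_reprK.
by rewrite !tens_addE catA.
Qed.
Fact tens_addC : commutative tens_add.
Proof. by move=> x y; apply/tens_piP/TensCatC. Qed.
Fact tens_add0 : left_id (tens_pi [::]) tens_add.
Proof. by move=> x; rewrite -[x]tens_reprK tens_addE. Qed.

Lemma tens_eq_zero s : tens_eq [seq (0 *: p.1, p.2) | p <- s] [::].
Proof.
elim: s => [|p s IHs] /=; first exact: TensRefl.
by rewrite scale0r; exact: (TensCat (TensZero p.2) IHs).
Qed.

Lemma tens_eq_scaleD a b s :
  tens_eq [seq ((a + b) *: p.1, p.2) | p <- s]
    ([seq (a *: p.1, p.2) | p <- s] ++ [seq (b *: p.1, p.2) | p <- s]).
Proof.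
elim: s => [|p s IHs] /=; first exact: TensRefl.
rewrite scalerDl; apply: (TensTrans (TensCat (TensDl _ _ _) IHs)) => /=.
apply: (TensCat (s := [:: _]) (s' := [:: _]) (TensRefl _)).
set u := map _ _; set v := map _ _.
rewrite -[(b *: p.1, p.2) :: v]cat1s catA -[_ :: (u ++ v)]cat1s catA.
exact: (TensCat (TensCatC _ _) (TensRefl _)).
Qed.

Fact tens_addN : left_inverse (tens_pi [::]) (tens_scale (- 1)) tens_add.
Proof.
move=> x; rewrite -[x]tens_reprK tens_scaleE tens_addE; apply/tens_piP.
set s := tens_repr x; have := tens_eq_scaleD (- 1) 1 s.
rewrite addNr; have -> : [seq (1 *: p.1, p.2) | p <- s] = s.
  by rewrite -[RHS]map_id; apply: eq_map => -[m n]; rewrite scale1r.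
by move/TensSym/TensTrans; apply; exact: tens_eq_zero.
Qed.

HB.instance Definition _ :=
  GRing.isZmodule.Build tens tens_addA tens_addC tens_add0 tens_addN.

Lemma tens_piD s t : tens_pi (s ++ t) = tens_pi s + tens_pi t.
Proof. by rewrite -tens_addE. Qed.

Fact tens_scalerA a b x : tens_scale a (tens_scale b x) = tens_scale (a * b) x.
Proof.
rewrite -[x]tens_reprK !tens_scaleE -map_comp; congr tens_pi.
by apply: eq_map => p /=; rewrite scalerA.
Qed.
Fact tens_scale1r : left_id 1 tens_scale.
Proof.
move=> x; rewrite -[x]tens_reprK tens_scaleE; congr tens_pi.
by rewrite -[RHS]map_id; apply: eq_map => -[m n]; rewrite scale1r.
Qed.
Fact tens_scalerDr : right_distributive tens_scale +%R.
Proof.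
move=> a x y; rewrite -[x]tens_reprK -[y]tens_reprK -tens_piD !tens_scaleE.
by rewrite map_cat tens_piD.
Qed.
Fact tens_scalerDl x : {morph tens_scale^~ x : a b / a + b}.
Proof.
move=> a b; rewrite -[x]tens_reprK !tens_scaleE -tens_piD.
exact/tens_piP/tens_eq_scaleD.
Qed.
HB.instance Definition _ := GRing.Zmodule_isLmodule.Build k tens
  tens_scalerA tens_scale1r tens_scalerDr tens_scalerDl.

Lemma tnDl m m' n : tn (m + m') n = tn m n + tn m' n.
Proof. by rewrite -tens_piD; apply/tens_piP/TensDl. Qed.
Lemma tnDr m n n' : tn m (n + n') = tn m n + tn m n'.
Proof. by rewrite -tens_piD; apply/tens_piP/TensDr. Qed.
Lemma tnZl a m n : tn (a *: m) n = a *: tn m n.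
Proof. by symmetry; exact: tens_scaleE. Qed.
Lemma tnZr a m n : tn m (a *: n) = a *: tn m n.
Proof. by rewrite -tnZl; apply/tens_piP/TensSym/TensZ. Qed.

Lemma tens_ind (P : tens -> Prop) :
    P 0 -> (forall m n x, P x -> P (tn m n + x)) -> forall x, P x.
Proof.
move=> P0 PD x; rewrite -[x]tens_reprK; elim: (tens_repr x) => // -[m n] s IHs.
by rewrite -cat1s tens_piD; exact: PD.
Qed.

Definition balanced (V : zmodType) (b : M -> N -> V) : Prop :=
  [/\ forall m m' n, b (m + m') n = b m n + b m' n,
      forall m n n', b m (n + n') = b m n + b m n' &
      forall (a : k) m n, b (a *: m) n = b m (a *: n)].

Definition tens_lift (V : zmodType) (b : M -> N -> V) (x : tens) : V :=
  \sum_(p <- tens_repr x) b p.1 p.2.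

Section Lift.
Variables (V : zmodType) (b : M -> N -> V) (bal : balanced b).

Lemma tens_liftE s : tens_lift b (tens_pi s) = \sum_(p <- s) b p.1 p.2.
Proof.
case: bal => bDl bDr bZ; rewrite /tens_lift.
move: (tens_repr _) (tens_repr_pi s) => r.
elim=> {r s} [s|s t _|s t u _ + _|s s' t t' _ ss _ tt|s t|n|m m' n|m n n'|a m n].
- by [].
- by move=> ->.
- by move=> ->.
- by rewrite !big_cat ss tt.
- by rewrite !big_cat /= addrC.
- rewrite big_seq1 big_nil /=; apply: (addrI (b 0 n)).
  by rewrite -bDl !addr0.
- by rewrite big_seq1 big_cons big_seq1 /= (bDl, bDr).
- by rewrite big_seq1 big_cons big_seq1 /= (bDl, bDr).
- by rewrite !big_seq1 /= bZ.
Qed.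

Lemma tens_lift_tn m n : tens_lift b (tn m n) = b m n.
Proof. by rewrite tens_liftE big_seq1. Qed.

Lemma tens_liftD x y : tens_lift b (x + y) = tens_lift b x + tens_lift b y.
Proof.
by rewrite -[x]tens_reprK -[y]tens_reprK -tens_piD !tens_liftE big_cat.
Qed.

Lemma tens_lift0 : tens_lift b 0 = 0.
Proof. by apply: (addrI (tens_lift b 0)); rewrite -tens_liftD !addr0. Qed.
End Lift.
End Tensor.

Section TensorMap.
Variables (k : comPzRingType) (M M' N N' : lmodType k).
Variables (u : {linear M -> M'}) (v : {linear N -> N'}).

Definition tens_map : tens M N -> tens M' N' :=
  tens_lift (fun m n => tn (u m) (v n)).

Lemma tens_map_balanced : balanced (fun m n => tn (u m) (v n)).
Proof.
split=> *; first by rewrite linearD tnDl.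
  by rewrite linearD tnDr.
by rewrite !linearZ /= tnZl tnZr.
Qed.

Lemma tens_map_tn m n : tens_map (tn m n) = tn (u m) (v n).
Proof. exact/tens_lift_tn/tens_map_balanced. Qed.

Fact tens_map_linear : linear tens_map.
Proof.
move=> a x y; rewrite /tens_map (tens_liftD tens_map_balanced); congr (_ + _).
elim/tens_ind: x => [|m n x IHx].
  by rewrite scaler0 (tens_lift0 tens_map_balanced) scaler0.
rewrite scalerDr !(tens_liftD tens_map_balanced) IHx scalerDr -tnZl.
by rewrite !(tens_lift_tn tens_map_balanced) linearZ /= tnZl.
Qed.
HB.instance Definition _ :=
  GRing.isLinear.Build k (tens M N) (tens M' N') *:%R tens_map tens_map_linear.
End TensorMap.

Definition flat (k : comPzRingType) (M : lmodType k) : Prop :=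
  forall (X Y Z : lmodType k) (u : {linear X -> Y}) (v : {linear Y -> Z}),
    exact u v -> exact (tens_map (@idfun M) u) (tens_map (@idfun M) v).

Definition faithfully_flat (k : comPzRingType) (M : lmodType k) : Prop :=
  forall (X Y Z : lmodType k) (u : {linear X -> Y}) (v : {linear Y -> Z}),
    exact u v <-> exact (tens_map (@idfun M) u) (tens_map (@idfun M) v).

(* The zero algebra has to be allowed, since A_S and B may vanish even when  *)
(* A and S do not, whereas the algType of the library is nontrivial; so an   *)
(* associative unital k-algebra is a ring with a central structure map.      *)
Record algebra (k : comPzRingType) := Algebra {
  alg_ring :> pzRingType;
  alg_map : {rmorphism k -> alg_ring};
  alg_mapC : forall a x, alg_map a * x = x * alg_map a
}.

Section AlgebraModule.
Variables (k : comPzRingType) (A : algebra k).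
Definition amod : Type := A.
HB.instance Definition _ := GRing.Zmodule.on amod.
Definition amod_scale (a : k) (x : amod) : amod := alg_map A a * (x : A).
Fact amod_scalerA a b x : amod_scale a (amod_scale b x) = amod_scale (a * b) x.
Proof. by rewrite /amod_scale mulrA rmorphM. Qed.
Fact amod_scale1r : left_id 1 amod_scale.
Proof. by move=> x; rewrite /amod_scale rmorph1 mul1r. Qed.
Fact amod_scalerDr : right_distributive amod_scale +%R.
Proof. by move=> a x y; exact: mulrDr. Qed.
Fact amod_scalerDl x : {morph amod_scale^~ x : a b / a + b}.
Proof. by move=> a b; rewrite /amod_scale rmorphD /= mulrDl. Qed.
HB.instance Definition _ := GRing.Zmodule_isLmodule.Build k amod
  amod_scalerA amod_scale1r amod_scalerDr amod_scalerDl.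
End AlgebraModule.

Section BasicAlgebras.
Variables (k : comPzRingType).

Definition com_alg (R : comPzRingType) (f : {rmorphism k -> R}) : algebra k :=
  @Algebra k R f (fun a x => mulrC (f a) x).

Fact op_map_monoid (A : algebra k) :
  monoid_morphism (alg_map A : k -> (alg_ring A)^c).
Proof.
split=> [|a b]; first exact: (rmorph1 (alg_map A)).
by rewrite -[RHS]/(alg_map A b * alg_map A a) -rmorphM mulrC.
Qed.
Definition op_map (A : algebra k) : k -> (alg_ring A)^c := alg_map A.
HB.instance Definition _ (A : algebra k) :=
  GRing.isZmodMorphism.Build k (alg_ring A)^c (op_map A) (@rmorphB _ _ (alg_map A)).
HB.instance Definition _ (A : algebra k) :=
  GRing.isMonoidMorphism.Build k (alg_ring A)^c (op_map A) (op_map_monoid A).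

Definition op_alg (A : algebra k) : algebra k :=
  @Algebra k (alg_ring A)^c (op_map A) (fun a x => esym (alg_mapC a (x : A))).

Definition restr_alg (k' : comPzRingType) (f : {rmorphism k' -> k})
    (A : algebra k) : algebra k' :=
  @Algebra k' A (alg_map A \o f) (fun a x => alg_mapC (f a) x).
End BasicAlgebras.

Section TensorAlgebra.
Variables (k : comPzRingType) (A C : algebra k).

Definition tens_ring : Type := tens (amod A) (amod C).
HB.instance Definition _ := GRing.Zmodule.on tens_ring.

Definition tnr (a : A) (c : C) : tens_ring := @tn k (amod A) (amod C) a c.

Definition tens_mul1 (a : A) (c : C) (y : tens_ring) : tens_ring :=
  @tens_lift k (amod A) (amod C) tens_ring
    (fun a' c' => tnr (a * (a' : A)) (c * (c' : C))) y.

Definition tens_mul (x y : tens_ring) : tens_ring :=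
  @tens_lift k (amod A) (amod C) tens_ring (fun a c => tens_mul1 a c y) x.

Lemma tnrDl a a' c : tnr (a + a') c = tnr a c + tnr a' c.
Proof. exact: (@tnDl k (amod A) (amod C)). Qed.
Lemma tnrDr a c c' : tnr a (c + c') = tnr a c + tnr a c'.
Proof. exact: (@tnDr k (amod A) (amod C)). Qed.
Lemma tnrZ z a c : tnr (alg_map A z * a) c = tnr a (alg_map C z * c).
Proof.
rewrite /tnr -[alg_map A z * a]/(z *: (a : amod A)).
by rewrite -[alg_map C z * c]/(z *: (c : amod C)) tnZl tnZr.
Qed.

Lemma tens_ring_ind (P : tens_ring -> Prop) :
    P 0 -> (forall a c x, P x -> P (tnr a c + x)) -> forall x, P x.
Proof. exact: (@tens_ind k (amod A) (amod C)). Qed.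

Lemma tens_mul1_balanced a c : @balanced k (amod A) (amod C) tens_ring
  (fun a' c' => tnr (a * (a' : A)) (c * (c' : C))).
Proof.
split=> [a1 a2 c1|a1 c1 c2|z a1 c1].
- by rewrite -[a * _]/(a * ((a1 : A) + (a2 : A))) mulrDr tnrDl.
- by rewrite -[c * _]/(c * ((c1 : C) + (c2 : C))) mulrDr tnrDr.
- change (tnr (a * (alg_map A z * (a1 : A))) (c * (c1 : C)) =
          tnr (a * (a1 : A)) (c * (alg_map C z * (c1 : C)))).
  by rewrite mulrA -alg_mapC -mulrA tnrZ mulrA alg_mapC -mulrA.
Qed.

Lemma tens_mul1_tn a c a' c' : tens_mul1 a c (tnr a' c') = tnr (a * a') (c * c').
Proof. exact/tens_lift_tn/tens_mul1_balanced. Qed.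
Lemma tens_mul1D a c x y :
  tens_mul1 a c (x + y) = tens_mul1 a c x + tens_mul1 a c y.
Proof. exact/tens_liftD/tens_mul1_balanced. Qed.
Lemma tens_mul10 a c : tens_mul1 a c 0 = 0.
Proof. exact/tens_lift0/tens_mul1_balanced. Qed.

Lemma tens_mul_balanced y : @balanced k (amod A) (amod C) tens_ring
  (fun a c => tens_mul1 a c y).
Proof.
split=> [a1 a2 c1|a1 c1 c2|z a1 c1]; elim/tens_ring_ind: y => [|a c x IHx];
  rewrite ?tens_mul10 ?addr0 // !tens_mul1D IHx !tens_mul1_tn.
- by rewrite mulrDl tnrDl addrACA.
- by rewrite mulrDl tnrDr addrACA.
- congr (_ + _); rewrite -[z *: a1]/(alg_map A z * (a1 : A)).
  by rewrite -[z *: c1]/(alg_map C z * (c1 : C)) -!mulrA tnrZ.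
Qed.

Lemma tens_mul_tnl a c y : tens_mul (tnr a c) y = tens_mul1 a c y.
Proof. exact/(tens_lift_tn (tens_mul_balanced y)). Qed.
Lemma tens_mul0 y : tens_mul 0 y = 0.
Proof. exact/(tens_lift0 (tens_mul_balanced y)). Qed.
Fact tens_mulDl : left_distributive tens_mul +%R.
Proof. by move=> x x' y; exact/(tens_liftD (tens_mul_balanced y)). Qed.
Fact tens_mulDr : right_distributive tens_mul +%R.
Proof.
move=> x y y'; elim/tens_ring_ind: x => [|a c x IHx].
  by rewrite !tens_mul0 addr0.
by rewrite !tens_mulDl IHx !tens_mul_tnl tens_mul1D addrACA.
Qed.
Lemma tens_mul_tn a c a' c' :
  tens_mul (tnr a c) (tnr a' c') = tnr (a * a') (c * c').
Proof. by rewrite tens_mul_tnl tens_mul1_tn. Qed.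
Lemma tens_mulr0 x : tens_mul x 0 = 0.
Proof. by apply: (addrI (tens_mul x 0)); rewrite -tens_mulDr !addr0. Qed.

Fact tens_mulA : associative tens_mul.
Proof.
move=> x y z; elim/tens_ring_ind: x => [|a c x IHx].
  by rewrite !tens_mul0.
rewrite !tens_mulDl IHx; congr (_ + _).
elim/tens_ring_ind: y {x IHx} => [|a' c' y IHy].
  by rewrite tens_mul0 tens_mulr0 tens_mul0.
rewrite tens_mulDl !tens_mulDr tens_mulDl IHy; congr (_ + _).
elim/tens_ring_ind: z {y IHy} => [|a2 c2 z IHz].
  by rewrite !tens_mulr0.
by rewrite !tens_mulDr IHz !tens_mul_tn !mulrA.
Qed.
Fact tens_mul1l : left_id (tnr 1 1) tens_mul.
Proof.
move=> x; elim/tens_ring_ind: x => [|a c x IHx]; first exact: tens_mulr0.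
by rewrite tens_mulDr IHx tens_mul_tn !mul1r.
Qed.
Fact tens_mul1r : right_id (tnr 1 1) tens_mul.
Proof.
move=> x; elim/tens_ring_ind: x => [|a c x IHx]; first exact: tens_mul0.
by rewrite tens_mulDl IHx tens_mul_tn !mulr1.
Qed.
HB.instance Definition _ := GRing.Zmodule_isPzRing.Build tens_ring
  tens_mulA tens_mul1l tens_mul1r tens_mulDl tens_mulDr.

Lemma tnrM a c a' c' : tnr a c * tnr a' c' = tnr (a * a') (c * c').
Proof. exact: tens_mul_tn. Qed.
End TensorAlgebra.

Section BaseChange.
Variables (k S : comPzRingType) (f : {rmorphism k -> S}) (A : algebra k).

Definition base_ring : Type := tens_ring A (com_alg f).
HB.instance Definition _ := GRing.PzRing.on base_ring.

Definition btn (a : A) (s : S) : base_ring := @tnr k A (com_alg f) a s.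
Definition base_map (s : S) : base_ring := btn 1 s.

Fact base_map_additive : zmod_morphism base_map.
Proof.
move=> s t; apply/eqP; rewrite eq_sym subr_eq; apply/eqP.
by rewrite -[RHS](@tnrDr k A (com_alg f)) subrK.
Qed.
Fact base_map_monoid : monoid_morphism base_map.
Proof.
by split=> // s t; rewrite [RHS](@tnrM k A (com_alg f)) mul1r.
Qed.
HB.instance Definition _ :=
  GRing.isZmodMorphism.Build S base_ring base_map base_map_additive.
HB.instance Definition _ :=
  GRing.isMonoidMorphism.Build S base_ring base_map base_map_monoid.

Fact base_mapC s (x : base_ring) : base_map s * x = x * base_map s.
Proof.
elim/(@tens_ring_ind k A (com_alg f)): x => [|a c x IHx].
  by rewrite mulr0 mul0r.
rewrite mulrDr mulrDl IHx; congr (_ + _).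
rewrite [LHS](@tnrM k A (com_alg f)) [RHS](@tnrM k A (com_alg f)).
by rewrite mul1r mulr1 [in LHS](mulrC (s : S) (c : S)).
Qed.

Definition base_alg : algebra S := @Algebra S base_ring base_map base_mapC.
End BaseChange.

Definition alg_iso (R : comPzRingType) (B C : algebra R)
    (phi : {rmorphism B -> C}) : Prop :=
  (forall r, phi (alg_map B r) = alg_map C r) /\ bijective phi.

(* A subring containing the image of R is an R-submodule, since the scalar   *)
(* action of R is multiplication by that image.                              *)
Record subalgebra (R : comPzRingType) (A : algebra R) := Subalgebra {
  subalg_set :> {pred A};
  subalg_subring : subring_closed subalg_set;
  subalg_scale : forall r, alg_map A r \in subalg_set
}.

Section SubalgebraAlgebra.
Variables (R : comPzRingType) (A : algebra R) (B : subalgebra A).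

Record subalg_sort : Type :=
  SubalgElt { subalg_val : A; _ : subalg_val \in subalg_set B }.
HB.instance Definition _ := [isSub for subalg_val].
HB.instance Definition _ := [Choice of subalg_sort by <:].
HB.instance Definition _ :=
  GRing.SubChoice_isSubPzRing.Build A (subalg_set B) subalg_sort
    (subalg_subring B).

Definition subalg_map (r : R) : subalg_sort :=
  @SubalgElt (alg_map A r) (subalg_scale B r).
Fact subalg_map_additive : zmod_morphism subalg_map.
Proof. by move=> r s; apply: val_inj; rewrite /= rmorphB. Qed.
Fact subalg_map_monoid : monoid_morphism subalg_map.
Proof. by split=> [|r s]; apply: val_inj; rewrite /= ?rmorph1 ?rmorphM. Qed.
HB.instance Definition _ :=
  GRing.isZmodMorphism.Build R subalg_sort subalg_map subalg_map_additive.
HB.instance Definition _ :=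
  GRing.isMonoidMorphism.Build R subalg_sort subalg_map subalg_map_monoid.
Fact subalg_mapC r (x : subalg_sort) : subalg_map r * x = x * subalg_map r.
Proof. by apply: val_inj; rewrite !rmorphM; exact: alg_mapC. Qed.

Definition subalg_alg : algebra R :=
  @Algebra R subalg_sort subalg_map subalg_mapC.
End SubalgebraAlgebra.
Coercion subalg_alg : subalgebra >-> algebra.

Section Forms.
Variables (k R S : comPzRingType).
Variables (f : {rmorphism k -> R}) (g : {rmorphism R -> S}) (A : algebra k).

Definition AS : algebra S := base_alg (g \o f) A.
Definition AS_R : algebra R := restr_alg g AS.

(* The homomorphism B (x)_R S -> A_S, b (x) s |-> s b is an isomorphism of   *)
(* S-algebras.                                                               *)
Definition is_form (B : subalgebra AS_R) : Prop :=
  exists phi : {rmorphism base_alg g B -> AS},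
    alg_iso phi /\
    forall (b : subalg_sort B) (s : S),
      phi (@btn R S g B b s) = alg_map AS s * (subalg_val b : AS).
End Forms.

Definition perfect (k : comPzRingType) (A : algebra k) : Prop :=
  forall a : A, exists s : seq (A * A), a = \sum_(p <- s) p.1 * p.2.

(* A as a left module over its enveloping algebra A (x)_k A^op, through      *)
(* (a (x) b) . x = a x b.                                                    *)
Section Enveloping.
Variables (k : comPzRingType) (A : algebra k).

Definition env_alg : Type := tens_ring A (op_alg A).
HB.instance Definition _ := GRing.PzRing.on env_alg.

Definition env_mod : Type := A.
HB.instance Definition _ := GRing.Zmodule.on env_mod.

Definition env_scale (z : env_alg) (x : env_mod) : env_mod :=
  @tens_lift k (amod A) (amod (op_alg A)) env_mod
    (fun a b => (a : A) * (x : A) * (b : A)) z.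

Lemma env_balanced (x : env_mod) :
  @balanced k (amod A) (amod (op_alg A)) env_mod
    (fun a b => (a : A) * (x : A) * (b : A)).
Proof.
split=> [a a' b|a b b'|r a b].
- by rewrite -!mulrA; exact: (@mulrDl A).
- exact: (@mulrDr A).
- change ((alg_map A r * (a : A)) * (x : A) * (b : A) =
          (a : A) * (x : A) * ((b : A) * alg_map A r)).
  by rewrite mulrA -[RHS]alg_mapC !mulrA.
Qed.

Lemma env_scale_tn (a b : A) x :
  env_scale (@tnr k A (op_alg A) a b) x = a * (x : A) * b.
Proof. exact/tens_lift_tn/env_balanced. Qed.

Fact env_scalerDl x : {morph env_scale^~ x : z z' / z + z'}.
Proof. by move=> z z'; exact/tens_liftD/env_balanced. Qed.
Lemma env_scale0 x : env_scale 0 x = 0.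
Proof. exact/tens_lift0/env_balanced. Qed.
Fact env_scalerDr : right_distributive env_scale +%R.
Proof.
move=> z x y; elim/(@tens_ring_ind k A (op_alg A)): z => [|a b z IHz].
  by rewrite !env_scale0 addr0.
rewrite !env_scalerDl IHz !env_scale_tn addrACA; congr (_ + _).
by rewrite -mulrDl -mulrDr.
Qed.
Lemma env_scaler0 z : env_scale z 0 = 0.
Proof. by apply: (addrI (env_scale z 0)); rewrite -env_scalerDr !addr0. Qed.
Fact env_scalerA z z' x : env_scale z (env_scale z' x) = env_scale (z * z') x.
Proof.
elim/(@tens_ring_ind k A (op_alg A)): z => [|a b z IHz].
  by rewrite mul0r !env_scale0.
rewrite mulrDl !env_scalerDl IHz; congr (_ + _).
elim/(@tens_ring_ind k A (op_alg A)): z' {z IHz} => [|a' b' z' IHz].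
  by rewrite mulr0 !env_scale0 env_scaler0.
rewrite mulrDr !env_scalerDl env_scalerDr IHz; congr (_ + _).
rewrite [_ * _](@tnrM k A (op_alg A)) !env_scale_tn.
change ((a : A) * ((a' : A) * (x : A) * (b' : A)) * (b : A) =
        (a : A) * (a' : A) * (x : A) * ((b' : A) * (b : A))).
by rewrite !mulrA.
Qed.
Fact env_scale1r : left_id 1 env_scale.
Proof. by move=> x; rewrite [LHS]env_scale_tn mul1r mulr1. Qed.
HB.instance Definition _ := GRing.Zmodule_isLmodule.Build env_alg env_mod
  env_scalerA env_scale1r env_scalerDr env_scalerDl.
End Enveloping.

Definition separable (k : comPzRingType) (A : algebra k) : Prop :=
  @projective (env_alg A) (env_mod A).

Definition formally_etale (R S : comPzRingType) (g : {rmorphism R -> S}) :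
    Prop :=
  forall (C D : comPzRingType) (p : {rmorphism C -> D})
    (c : {rmorphism R -> C}) (h : {rmorphism S -> D}),
    (forall y, exists x, p x = y) ->
    (forall x y, p x = 0 -> p y = 0 -> x * y = 0) ->
    (forall r, p (c r) = h (g r)) ->
  exists l : {rmorphism S -> C},
    [/\ forall s, p (l s) = h s, forall r, l (g r) = c r &
        forall l' : {rmorphism S -> C}, (forall s, p (l' s) = h s) ->
          (forall r, l' (g r) = c r) -> l' =1 l].

(* Polynomial expressions in n variables over R; the {mpoly R[n]} of the     *)
(* library needs 1 != 0 in R.                                                *)
Inductive pexpr (R : Type) (n : nat) : Type :=
| PVar of 'I_n
| PConst of R
| PAdd of pexpr R n & pexpr R n
| PMul of pexpr R n & pexpr R n.

Fixpoint peval (R C : comPzRingType) (c : R -> C) (n : nat) (x : 'I_n -> C)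
    (e : pexpr R n) : C :=
  match e with
  | PVar i => x i
  | PConst r => c r
  | PAdd e1 e2 => peval c x e1 + peval c x e2
  | PMul e1 e2 => peval c x e1 * peval c x e2
  end.

(* S = R[X_1, ..., X_n] / (e_1, ..., e_m), by the universal property of the  *)
(* algebra with n generators and m relations.                                *)
Definition fp_alg (R S : comPzRingType) (g : {rmorphism R -> S}) : Prop :=
  exists (n m : nat) (x : 'I_n -> S) (e : 'I_m -> pexpr R n),
    (forall j, peval g x (e j) = 0) /\
    forall (C : comPzRingType) (c : {rmorphism R -> C}) (y : 'I_n -> C),
      (forall j, peval c y (e j) = 0) ->
    exists h : {rmorphism S -> C},
      [/\ forall r, h (g r) = c r, forall i, h (x i) = y i &
          forall h' : {rmorphism S -> C}, (forall r, h' (g r) = c r) ->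
            (forall i, h' (x i) = y i) -> h' =1 h].

Definition etale (R S : comPzRingType) (g : {rmorphism R -> S}) : Prop :=
  fp_alg g /\ formally_etale g.

(* B-bimodules over R; by the last two laws they are unital.                 *)
Record bimod (R : comPzRingType) (B : algebra R) := Bimod {
  bimod_mod :> lmodType R;
  lact : B -> bimod_mod -> bimod_mod;
  ract : bimod_mod -> B -> bimod_mod;
  lactDl : forall b b' n, lact (b + b') n = lact b n + lact b' n;
  lactDr : forall b n n', lact b (n + n') = lact b n + lact b n';
  ractDl : forall n n' b, ract (n + n') b = ract n b + ract n' b;
  ractDr : forall n b b', ract n (b + b') = ract n b + ract n b';
  lactA : forall b b' n, lact (b * b') n = lact b (lact b' n);
  ractA : forall n b b', ract n (b * b') = ract (ract n b) b';
  lractA : forall b n b', ract (lact b n) b' = lact b (ract n b');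
  lact_scal : forall r n, lact (alg_map B r) n = r *: n;
  ract_scal : forall r n, ract n (alg_map B r) = r *: n
}.

Section BimodTheory.
Variables (R : comPzRingType) (B : algebra R) (N : bimod B).

Lemma lactZ (b : B) r (n : N) : lact b (r *: n) = r *: lact b n.
Proof. by rewrite -!lact_scal -!lactA alg_mapC. Qed.
Lemma ractZ (b : B) r (n : N) : ract (r *: n) b = r *: ract n b.
Proof. by rewrite -!ract_scal -!ractA alg_mapC. Qed.

Definition lact_map (b : B) (n : N) : N := lact b n.
Definition ract_map (b : B) (n : N) : N := ract n b.
Fact lact_map_linear b : linear (lact_map b).
Proof. by move=> r n n'; rewrite /lact_map lactDr lactZ. Qed.
Fact ract_map_linear b : linear (ract_map b).
Proof. by move=> r n n'; rewrite /ract_map ractDl ractZ. Qed.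
HB.instance Definition _ b :=
  GRing.isLinear.Build R N N *:%R (lact_map b) (lact_map_linear b).
HB.instance Definition _ b :=
  GRing.isLinear.Build R N N *:%R (ract_map b) (ract_map_linear b).

Definition is_der (d : amod B -> N) : Prop :=
  linear d /\
  forall b1 b2 : B, d (b1 * b2) = ract (d b1) b2 + lact b1 (d b2).

Definition is_inner (d : amod B -> N) : Prop :=
  exists n : N, forall b : B, d b = lact b n - ract n b.

Definition is_ctd (chi : amod B -> N) : Prop :=
  linear chi /\
  forall b1 b2 : B, chi (b1 * b2) = ract (chi b1) b2 /\
                    chi (b1 * b2) = lact b1 (chi b2).

Definition der_pred : {pred amod B -> N} := fun d => `[< is_der d >].
Definition ctd_pred : {pred amod B -> N} := fun chi => `[< is_ctd chi >].

Fact linear_cst0 : linear (0 : amod B -> N).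
Proof. by move=> r x y; rewrite /= scaler0 addr0. Qed.
Fact linear_comb r (d d' : amod B -> N) :
  linear d -> linear d' -> linear (r *: d + d').
Proof.
move=> dL d'L s x y.
rewrite -![(r *: d + d') _]/(r *: d _ + d' _) dL d'L !scalerDr !scalerA.
by rewrite mulrC addrACA.
Qed.

Lemma lact0 (b : B) : lact b (0 : N) = 0.
Proof. exact: (linear0 (lact_map b)). Qed.
Lemma ract0 (b : B) : ract (0 : N) b = 0.
Proof. exact: (linear0 (ract_map b)). Qed.

Fact der_closed : submod_closed der_pred.
Proof.
split; first by apply/asboolP; split=> [|b1 b2];
  [exact: linear_cst0 | rewrite /= lact0 ract0 addr0].
move=> r d d' /asboolP[dL dD] /asboolP[d'L d'D]; apply/asboolP.
split; first exact: linear_comb.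
move=> b1 b2; rewrite -![(r *: d + d') _]/(r *: d _ + d' _) dD d'D.
by rewrite ractDl lactDr lactZ ractZ scalerDr addrACA.
Qed.

Fact ctd_closed : submod_closed ctd_pred.
Proof.
split; first by apply/asboolP; split=> [|b1 b2];
  [exact: linear_cst0 | rewrite /= lact0 ract0].
move=> r d d' /asboolP[dL dD] /asboolP[d'L d'D]; apply/asboolP.
split; first exact: linear_comb.
move=> b1 b2; rewrite -![(r *: d + d') _]/(r *: d _ + d' _).
rewrite ractDl lactDr lactZ ractZ.
by case: (dD b1 b2) => <- <-; case: (d'D b1 b2) => <- <-.
Qed.

Record der : Type := Der { der_fun :> amod B -> N; _ : der_fun \in der_pred }.
HB.instance Definition _ := [isSub for der_fun].
HB.instance Definition _ := [Choice of der by <:].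
HB.instance Definition _ :=
  GRing.SubChoice_isSubLmodule.Build R (amod B -> N) der_pred der
    (GRing.submod_closed_semi der_closed).

Record ctd : Type := Ctd { ctd_fun :> amod B -> N; _ : ctd_fun \in ctd_pred }.
HB.instance Definition _ := [isSub for ctd_fun].
HB.instance Definition _ := [Choice of ctd by <:].
HB.instance Definition _ :=
  GRing.SubChoice_isSubLmodule.Build R (amod B -> N) ctd_pred ctd
    (GRing.submod_closed_semi ctd_closed).

Definition inner_pred : {pred der} := fun d => `[< is_inner d >].

Fact inner_closed : submod_closed inner_pred.
Proof.
split; first by apply/asboolP; exists 0 => b; rewrite lact0 ract0 subr0.
move=> r d d' /asboolP[n dE] /asboolP[n' d'E]; apply/asboolP.
exists (r *: n + n') => b.
rewrite -[LHS]/(r *: d b + d' b) dE d'E lactDr ractDl lactZ ractZ.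
by rewrite scalerBr opprD addrACA.
Qed.

Definition HH1 : Type := lquot inner_closed.
HB.instance Definition _ := GRing.Lmodule.on HH1.
End BimodTheory.
Arguments is_der {R B} N d.
Arguments is_inner {R B} N d.
Arguments is_ctd {R B} N chi.
Arguments der_pred {R B} N _.
Arguments ctd_pred {R B} N _.
Arguments inner_pred {R B} N _.

Section RegularBimodule.
Variables (R : comPzRingType) (B : algebra R).

Definition reg_bimod : bimod B :=
  @Bimod R B (amod B) (fun b n => b * (n : B)) (fun n b => (n : B) * b)
    (fun b b' n => mulrDl b b' (n : B)) (fun b n n' => mulrDr b (n : B) (n' : B))
    (fun n n' b => mulrDl (n : B) (n' : B) b) (fun n b b' => mulrDr (n : B) b b')
    (fun b b' n => esym (mulrA b b' (n : B)))
    (fun n b b' => mulrA (n : B) b b')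
    (fun b n b' => esym (mulrA b (n : B) b'))
    (fun r n => erefl) (fun r n => esym (alg_mapC r (n : B))).

Definition center_pred : {pred amod B} :=
  fun z => `[< forall b : B, (z : B) * b = b * (z : B) >].
Fact center_closed : submod_closed center_pred.
Proof.
split; first by apply/asboolP => b; rewrite (mul0r b) (mulr0 b).
move=> r z z' /asboolP zC /asboolP z'C; apply/asboolP => b.
change ((alg_map B r * (z : B) + (z' : B)) * b =
        b * (alg_map B r * (z : B) + (z' : B))).
by rewrite mulrDl mulrDr z'C -mulrA zC !mulrA alg_mapC.
Qed.

Record center : Type := Center { center_val : amod B; _ : center_val \in center_pred }.
HB.instance Definition _ := [isSub for center_val].
HB.instance Definition _ := [Choice of center by <:].
HB.instance Definition _ :=
  GRing.SubChoice_isSubLmodule.Build R (amod B) center_pred center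
    (GRing.submod_closed_semi center_closed).

Fact homothety_is_ctd (r : R) :
  (fun b => r *: b : amod B) \in ctd_pred reg_bimod.
Proof.
apply/asboolP; split=> [s x y|b1 b2].
  by rewrite scalerDr !scalerA mulrC.
by split; [exact: mulrA | rewrite -[RHS]/(b1 * (alg_map B r * b2)) mulrA
  -alg_mapC -mulrA].
Qed.
(* R -> Ctd_R(B, B) *)
Definition homothety (r : R) : ctd reg_bimod := Ctd (homothety_is_ctd r).

Definition central : Prop := bijective homothety.
End RegularBimodule.
Arguments center_pred {R} B _.

Section RestrictedBimodules.
Variables (k R : comPzRingType) (f : {rmorphism k -> R}) (B : algebra R).
Let Bk : algebra k := restr_alg f B.
Let Rk : algebra k := com_alg f.

(* For N a B-bimodule over R, the modules der, ctd and HH1 of restr_bimod N  *)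
(* are Der_k(B, N), Ctd_k(B, N) and HH^1(B, N); those of N itself are the    *)
(* R-linear versions.                                                        *)
Definition restr_bimod (N : bimod B) : bimod Bk :=
  @Bimod k Bk (restr f N) (@lact R B N) (@ract R B N)
    (@lactDl R B N) (@lactDr R B N) (@ractDl R B N) (@ractDr R B N)
    (@lactA R B N) (@ractA R B N) (@lractA R B N)
    (fun a n => lact_scal (f a) n) (fun a n => ract_scal (f a) n).

Section CentroidBimod.
Variable N : bimod B.
Local Notation ctdk := (ctd (restr_bimod N)).

Fact ctd_lact_subproof (r : R) (chi : ctdk) :
  (fun b => r *: (chi b : N) : restr f N) \in ctd_pred (restr_bimod N).
Proof.
case: chi => chi /= /asboolP[chiL chiM]; apply/asboolP; split=> [a x y|b1 b2].
  rewrite chiL -![a *: _]/(f a *: (_ : N)) scalerDr; congr (_ + _).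
  by rewrite (scalerA r (f a) (chi x : N)) mulrC -scalerA.
case: (chiM b1 b2) => E1 E2; split.
  by rewrite E1 -[RHS]/(ract (r *: (chi b1 : N)) b2) ractZ.
by rewrite E2 -[RHS]/(lact (b1 : B) (r *: (chi b2 : N))) lactZ.
Qed.
Definition ctd_lact (r : R) (chi : ctdk) : ctdk := Ctd (ctd_lact_subproof r chi).

Fact ctd_ract_subproof (chi : ctdk) (r : R) :
  (fun b : amod Bk => chi (alg_map B r * (b : B))) \in ctd_pred (restr_bimod N).
Proof.
case: chi => chi /= /asboolP[chiL chiM]; apply/asboolP; split=> [a x y|b1 b2].
  rewrite -chiL; congr chi.
  change (alg_map B r * (alg_map B (f a) * (x : B) + (y : B)) =
    alg_map B (f a) * (alg_map B r * (x : B)) + alg_map B r * (y : B)).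
  by rewrite mulrDr !mulrA -!rmorphM /= mulrC.
split.
  by rewrite mulrA; case: (chiM (alg_map B r * b1) b2).
by rewrite mulrA alg_mapC -mulrA; case: (chiM b1 (alg_map B r * b2)).
Qed.
Definition ctd_ract (chi : ctdk) (r : R) : ctdk := Ctd (ctd_ract_subproof chi r).

Lemma ctdP (chi chi' : ctdk) : (forall b, chi b = chi' b) -> chi = chi'.
Proof. by move=> E; apply: val_inj; apply: funext. Qed.

Lemma ctdDE (chi chi' : ctdk) b : (chi + chi') b = chi b + chi' b.
Proof. exact: (congr1 (fun h => h b) (raddfD val chi chi')). Qed.
Lemma ctdZE a (chi : ctdk) b : (a *: chi) b = a *: chi b.
Proof. exact: (congr1 (fun h => h b) (linearZ_LR val a chi)). Qed.

Lemma ctdk_linear (chi : ctdk) : linear (chi : amod Bk -> restr f N).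
Proof. by case: chi => chi /= /asboolP[]. Qed.

Lemma ctdkD (chi : ctdk) (x y : B) : chi (x + y) = (chi x : N) + chi y.
Proof. by have := ctdk_linear chi 1 x y; rewrite !scale1r. Qed.

Lemma ctdkZ (chi : ctdk) (a : k) (x : amod Bk) : chi (a *: x) = a *: chi x.
Proof.
have chi0 : chi 0 = 0.
  by apply: (addrI (chi 0)); rewrite -ctdkD !addr0.
by have := ctdk_linear chi a x 0; rewrite !addr0 chi0 addr0.
Qed.

(* Ctd_k(B, N) with (r . chi)(b) = r chi(b) and (chi . r)(b) = chi(r b). *)
Definition ctd_bimod : bimod Rk.
Proof.
apply: (@Bimod k Rk ctdk ctd_lact ctd_ract).
- by move=> r r' chi; apply: ctdP => b; rewrite ctdDE; exact: (scalerDl (chi b : N) r r').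
- move=> r chi chi'; apply: ctdP => b; rewrite [RHS]ctdDE.
  rewrite -[LHS]/(r *: ((chi + chi') b : N)) ctdDE.
  exact: (scalerDr r (chi b : N) (chi' b : N)).
- by move=> chi chi' r; apply: ctdP => b; rewrite [LHS]ctdDE [RHS]ctdDE.
- move=> chi r r'; apply: ctdP => b.
  rewrite [RHS]ctdDE -[LHS]/(chi (alg_map B (r + r') * (b : B))) rmorphD mulrDl.
  exact: ctdkD.
- by move=> r r' chi; apply: ctdP => b; rewrite /= scalerA.
- move=> chi r r'; apply: ctdP => b.
  rewrite -[LHS]/(chi (alg_map B (r * r') * (b : B))) rmorphM.
  by rewrite -mulrA.
- by move=> r chi r'; apply: ctdP.
- by move=> a chi; apply: ctdP => b; rewrite ctdZE.
- by move=> a chi; apply: ctdP => b; rewrite ctdZE; exact: ctdkZ.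
Defined.
End CentroidBimod.

Section CenterBimod.
Local Notation ctrk := (center Bk).

Fact center_lact_subproof (r : R) (z : ctrk) :
  (alg_map B r * (center_val z : B) : amod Bk) \in center_pred Bk.
Proof.
case: z => z /= /asboolP zC; apply/asboolP => b.
change (alg_map B r * (z : B) * (b : B) = (b : B) * (alg_map B r * (z : B))).
by rewrite -mulrA [_ * b]zC !mulrA alg_mapC.
Qed.
Definition center_lact (r : R) (z : ctrk) : ctrk :=
  Center (center_lact_subproof r z).

Definition center_bimod : bimod Rk.
Proof.
apply: (@Bimod k Rk ctrk center_lact (fun z r => center_lact r z)).
- by move=> r r' z; apply: val_inj; rewrite /= rmorphD mulrDl.
- by move=> r z z'; apply: val_inj; exact: mulrDr.
- by move=> z z' r; apply: val_inj; exact: mulrDr.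
- by move=> z r r'; apply: val_inj; rewrite /= rmorphD mulrDl.
- by move=> r r' z; apply: val_inj; rewrite /= rmorphM mulrA.
- by move=> z r r'; apply: val_inj; rewrite /= mulrC rmorphM mulrA.
- move=> r z r'; apply: val_inj.
  by rewrite /= !mulrA -!rmorphM /= mulrC.
- by move=> a z; apply: val_inj.
- by move=> a z; apply: val_inj.
Defined.
End CenterBimod.
End RestrictedBimodules.

Section BimoduleProjection.
Variables (R S : comPzRingType) (g : {rmorphism R -> S}).
Variables (B : algebra R) (N : bimod B).

Definition NS : lmodType R := tens N (amod (com_alg g)).
Definition NS_lact (b : B) (m : NS) : NS :=
  tens_map (lact_map b : {linear N -> N}) (@idfun (amod (com_alg g))) m.
Definition NS_ract (m : NS) (b : B) : NS :=
  tens_map (ract_map b : {linear N -> N}) (@idfun (amod (com_alg g))) m.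

Definition has_bimod_map : Prop :=
  exists pi : {linear NS -> N}, forall (b : B) (m : NS),
    pi (NS_lact b m) = lact b (pi m) /\ pi (NS_ract m b) = ract (pi m) b.
End BimoduleProjection.

(* Main.v *)
Require Import Defs.
From HB Require Import structures.
From mathcomp Require Import all_boot all_algebra.
From mathcomp Require Import boolp.
Set Implicit Arguments.
Unset Strict Implicit.
Unset Printing Implicit Defensive.
Import GRing.Theory.
Local Open Scope ring_scope.

(** Two statements about a form [B] of [A] and a [B]-bimodule [N] over [R] carry
    the whole theorem: an [R]-linear derivation [d] of [B] into [N] is inner
    ([form_inner]), and a [k]-linear derivation [D] of [R] into [N] whose values
    commute with [B] extends to a derivation of [B] ([form_extend_derivation]).

    Both are proved over [S] first and then descended.  Over [S] the algebra
    [B] becomes [A (x)_k S], acting on both sides of [S (x)_R N].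
    - A separability idempotent [sum x_i (x) y_i] of [A] writes the [S]-linear
      extension of [d] as the inner derivation of [sum x_i d(y_i)]
      ([separable_inner], [base_separable_inner]).
    - As [S] is formally etale over [R], [D] extends to a unique derivation of
      [S] into [S (x)_R N], whose values commute with [B] by uniqueness; then
      [a (x) s |-> a D(s)] extends it to [A (x)_k S] ([etale_derivation],
      [base_extend_derivation]).

    For the descent, both problems are finite systems of linear equations over
    [R] with unknowns in [N].  Such a system is solvable as soon as it is
    solvable in [S (x)_R N], because [S] is faithfully flat
    ([system_descent]).  For the first problem the unknown is the element
    implementing [d], with one equation for each generator of the [R]-module
    [B].  For the second, the unknowns are the values of the extension on the
    generators, and the equations come from their relations and their
    multiplication table ([descend_extension]).  Finiteness of these systems
    is the finite presentation of [B] over [R], which descends from that of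
    [A (x)_k S] over [S] ([bcm_fp], [fp_descent], [form_fp]).

    Finally, a [k]-linear derivation [d] of [B] gives the derivation
    [r |-> (b |-> d(r 1) b)] of [R] into the centroid ([base_der]).  Its kernel
    consists of the [R]-linear derivations, which are the inner ones, and it is
    surjective by the extension statement, since a centroid element [chi] is
    determined by [chi 1], which commutes with [B] ([HH1_base_iso]).  The forms
    of the result for [N = B] follow from the identification of the centroid
    with the centre, and of the centre with [R] when [B] is central. *)

(** * Linear maps, kernels, cokernels and free modules *)

Section Bundling.
Variables (k : pzRingType) (V W : lmodType k) (h : V -> W).
Hypothesis hL : linear h.
HB.instance Definition _ := GRing.isLinear.Build k V W *:%R h hL.
(** Bundles a function with a linearity proof found in the course of a proof. *)
Definition lin : {linear V -> W} := h.
Lemma linE x : lin x = h x. Proof. by []. Qed.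
End Bundling.
Arguments lin : simpl never.

Lemma bijective_inj_surj (T U : choiceType) (h : T -> U) :
  injective h -> (forall y, exists x, h x = y) -> bijective h.
Proof.
move=> hI hS; exists (fun y => projT1 (cid (hS y))) => [x|y].
  by apply: hI; case: cid.
by case: cid.
Qed.

Section QuotientIso.
Variables (k : pzRingType) (V W : lmodType k) (U : {pred V}).
Hypothesis U_closed : submod_closed U.

Lemma lquot_eq0 v : (lquot_pi U_closed v = 0) <-> v \in U.
Proof.
have -> : 0 = lquot_pi U_closed 0.
  by apply: (addrI (lquot_pi U_closed 0)); rewrite -lquot_piD !addr0.
split=> [/lquot_piP|vU]; rewrite ?subr0 //.
by apply/lquot_piP; rewrite subr0.
Qed.

Lemma lquot_surj x : exists v, lquot_pi U_closed v = x.
Proof. by eexists; exact: lquot_piK. Qed.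

Lemma lquot_piZ a v : lquot_pi U_closed (a *: v) = a *: lquot_pi U_closed v.
Proof. by rewrite -lquot_scaleE. Qed.

Fact lquot_pi_linear : linear (lquot_pi U_closed).
Proof. by move=> a v w; rewrite lquot_piD lquot_piZ. Qed.
HB.instance Definition _ := GRing.isLinear.Build k V (lquot U_closed) *:%R
  (lquot_pi U_closed) lquot_pi_linear.

Lemma lquot_iso (h : {linear V -> W}) :
    (forall w, exists v, h v = w) -> (forall v, h v = 0 <-> v \in U) ->
  lmod_iso (lquot U_closed) W.
Proof.
move=> hS hK.
pose q x := h (projT1 (cid (lquot_surj x))).
have qE v : q (lquot_pi U_closed v) = h v.
  rewrite /q; case: cid => w /= wv; apply/eqP; rewrite -subr_eq0 -linearB /=.
  by apply/eqP/hK/lquot_eq0; rewrite linearB /= wv subrr.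
have qL : linear q.
  move=> a x y; case: (lquot_surj x) (lquot_surj y) => v <- [w <-].
  by rewrite -lquot_piZ -lquot_piD !qE linearP.
exists (lin qL); apply: bijective_inj_surj => [x y|w]; last first.
  by case: (hS w) => v <-; exists (lquot_pi U_closed v); exact: qE.
case: (lquot_surj x) (lquot_surj y) => v <- [w <-]; rewrite !linE !qE => E.
apply/eqP; rewrite -subr_eq0 -linearB /=; apply/eqP/lquot_eq0/hK.
by rewrite linearB /= E subrr.
Qed.
End QuotientIso.

Lemma lmod_iso_sym (k : pzRingType) (V W : lmodType k) :
  lmod_iso V W -> lmod_iso W V.
Proof.
case=> phi [psi phiK psiK].
have psiL : linear psi.
  by move=> a x y; apply: (can_inj phiK); rewrite linearP !psiK.
by exists (lin psiL), phi.
Qed.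

Lemma lmod_iso_trans (k : pzRingType) (U V W : lmodType k) :
  lmod_iso U V -> lmod_iso V W -> lmod_iso U W.
Proof.
by case=> phi phiB [psi psiB]; exists (psi \o phi); exact: bij_comp.
Qed.

Section KernelCokernel.
Variables (k : pzRingType) (V W : lmodType k) (u : {linear V -> W}).

Definition im_pred : {pred W} := fun y => `[< exists x, u x = y >].
Fact im_closed : submod_closed im_pred.
Proof.
split; first by apply/asboolP; exists 0; exact: linear0.
move=> a _ _ /asboolP[x <-] /asboolP[y <-]; apply/asboolP.
by exists (a *: x + y); rewrite linearP.
Qed.

Lemma exists_coker : exists (Z : lmodType k) (v : {linear W -> Z}), exact u v.
Proof.
exists (lquot im_closed), (lquot_pi im_closed : {linear W -> _}) => y.
by split=> [/lquot_eq0/asboolP|yu]; last by apply/lquot_eq0/asboolP.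
Qed.

Definition ker_pred : {pred V} := fun x => u x == 0.
Fact ker_closed : submod_closed ker_pred.
Proof.
split; first by rewrite /in_mem /= /ker_pred linear0.
move=> a x y /eqP ux /eqP uy.
by rewrite /in_mem /= /ker_pred linearP ux uy scaler0 addr0.
Qed.
Record ker_sort : Type := KerElt { ker_val : V; _ : ker_val \in ker_pred }.
HB.instance Definition _ := [isSub for ker_val].
HB.instance Definition _ := [Choice of ker_sort by <:].
HB.instance Definition _ :=
  GRing.SubChoice_isSubLmodule.Build k V ker_pred ker_sort
    (GRing.submod_closed_semi ker_closed).

Lemma exists_ker : exists (X : lmodType k) (i : {linear X -> V}), exact i u.
Proof.
exists ker_sort, (val : {linear ker_sort -> V}) => x; split=> [/eqP ux|[y <-]].
  by exists (KerElt (ux : x \in ker_pred)).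
by apply/eqP; case: y.
Qed.
End KernelCokernel.

Section Combination.
Variables (R : pzRingType) (X : lmodType R) (n : nat).

Fact comb_linear (e : 'I_n -> X) : linear (fun x : 'rV[R]_n => \sum_i x 0 i *: e i).
Proof.
move=> a x y; rewrite scaler_sumr -big_split; apply: eq_bigr => i _ /=.
by rewrite !mxE scalerDl scalerA.
Qed.
Definition comb (e : 'I_n -> X) : {linear 'rV[R]_n -> X} := lin (comb_linear e).

Lemma combE e x : comb e x = \sum_i x 0 i *: e i. Proof. by []. Qed.
Lemma comb_delta e i : comb e 'e_i = e i.
Proof.
rewrite combE (bigD1 i) //= big1 => [|j ji]; rewrite mxE eqxx /=.
  by rewrite eqxx scale1r addr0.
by rewrite (negPf ji) scale0r.
Qed.
Lemma comb_uniq (h : {linear 'rV[R]_n -> X}) : h =1 comb (fun i => h 'e_i).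
Proof.
move=> x; rewrite {1}[x]row_sum_delta linear_sum.
by apply: eq_bigr => i _; rewrite linearZ.
Qed.
End Combination.
Arguments comb : simpl never.

Lemma gen_ind (R : pzRingType) (M : lmodType R) n (v : {linear 'rV[R]_n -> M})
    (P : M -> Prop) :
    (forall y, exists x, v x = y) ->
    P 0 -> (forall x y, P x -> P y -> P (x + y)) ->
    (forall (r : R) x, P x -> P (r *: x)) -> (forall i, P (v 'e_i)) ->
  forall y, P y.
Proof.
move=> vS P0 PD PZ Pe y; have [x <-] := vS y.
by rewrite comb_uniq combE; apply: big_ind => // i _; exact/PZ/Pe.
Qed.

Lemma lift_free (R : pzRingType) n (X Y : lmodType R) (p : {linear X -> Y})
    (h : {linear 'rV[R]_n -> Y}) :
  (forall y, exists x, p x = y) ->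
  exists l : {linear 'rV[R]_n -> X}, forall x, p (l x) = h x.
Proof.
move=> pS; exists (comb (fun i => projT1 (cid (pS (h 'e_i))))) => x.
rewrite combE linear_sum [RHS]comb_uniq; apply: eq_bigr => i _.
by rewrite linearZ /=; case: cid => y /= ->.
Qed.

(** Schanuel's argument: with lifts [b] and [c] between the two free covers, the
    kernel of [q] is generated by the image under [b] of the relations of the
    given presentation and by the defects [y - b (c y)]. *)
Lemma fp_kernel (R : pzRingType) (Q : lmodType R) n (q : {linear 'rV[R]_n -> Q}) :
  fp_module Q -> (forall y, exists x, q x = y) ->
  exists m (u : {linear 'rV[R]_m -> 'rV[R]_n}), exact u q.
Proof.
case=> m0 [n0 [u0 [p [u0p pS]]]] qS.
have [b bE] := lift_free p qS; have [c cE] := lift_free q pS.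
have uL : linear (fun x : 'rV[R]_(m0 + n) =>
    b (u0 (lsubmx x)) + (rsubmx x - b (c (rsubmx x)))).
  move=> a x y; rewrite !linearP /= scalerDr scalerBr [RHS]addrACA; congr (_ + _).
  by rewrite scalerN addrACA.
exists (m0 + n)%N, (lin uL) => y; split=> [qy|[x <-]]; last first.
  rewrite linE linearD linearB /= !bE cE subrr addr0.
  by apply/u0p; exists (lsubmx x).
have [t tE] : exists t, u0 t = c y by apply/u0p; rewrite cE.
by exists (row_mx t y); rewrite linE row_mxKl row_mxKr tE addrC subrK.
Qed.

Lemma fp_iso (R : pzRingType) (V W : lmodType R) :
  lmod_iso V W -> fp_module V -> fp_module W.
Proof.
case=> h [h' hK h'K] [m [n [u [p [up pS]]]]].
exists m, n, u, (h \o p); split=> [y|w]; last first.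
  by have [y E] := pS (h' w); exists y; rewrite /= E h'K.
rewrite -up /=; split=> [E|->]; last exact: linear0.
by apply: (can_inj hK); rewrite E linear0.
Qed.

(** * Base change of modules *)

Section TensorFunctor.
Variable k : comPzRingType.

Lemma eq_tens_map (M M' N N' : lmodType k)
    (u u' : {linear M -> M'}) (v v' : {linear N -> N'}) :
  u =1 u' -> v =1 v' -> tens_map u v =1 tens_map u' v'.
Proof.
move=> uE vE x; elim/tens_ind: x => [|m n x IHx]; first by rewrite !linear0.
by rewrite !linearD /= IHx !tens_map_tn uE vE.
Qed.

Lemma tn0l (M N : lmodType k) (n : N) : tn (0 : M) n = 0.
Proof. by rewrite -[X in tn X _](scale0r 0) tnZl scale0r. Qed.
Lemma tn0r (M N : lmodType k) (m : M) : tn m (0 : N) = 0.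
Proof. by rewrite -[X in tn _ X](scale0r 0) tnZr scale0r. Qed.

Lemma tn_sumr (M N : lmodType k) (m : M) I (r : seq I) (P : pred I) (F : I -> N) :
  tn m (\sum_(i <- r | P i) F i) = \sum_(i <- r | P i) tn m (F i).
Proof. by apply: (big_morph (tn m)) => [x y|]; rewrite ?tnDr ?tn0r. Qed.
End TensorFunctor.

Section BaseChange.
Variables (R S : comPzRingType) (g : {rmorphism R -> S}).
Local Notation SM := (amod (com_alg g)).

Section Scaling.
Variable X : lmodType R.

Fact scal_mul_linear (s : S) : linear (fun t : SM => (s * (t : S) : SM)).
Proof.
move=> r t t'; rewrite -[X in s * X]/(g r * (t : S) + (t' : S)).
by rewrite mulrDr mulrCA.
Qed.

(** [S (x)_R X]; the alias carries the scalar action of [S], whereas [tens]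
    carries that of [R]. *)
Definition bcm : Type := tens SM X.
HB.instance Definition _ := GRing.Zmodule.on bcm.
(** The elementary tensor [s (x) x]. *)
Definition btens (s : S) (x : X) : bcm := @tn R SM X s x.
Definition bcm_scale (s : S) (z : bcm) : bcm :=
  tens_map (lin (scal_mul_linear s)) (@idfun X) z.

Lemma bcm_scale_tn s t x : bcm_scale s (btens t x) = btens (s * t) x.
Proof. exact: tens_map_tn. Qed.
Lemma btensDl s t x : btens (s + t) x = btens s x + btens t x.
Proof. exact: tnDl. Qed.
Lemma btensDr s x y : btens s (x + y) = btens s x + btens s y.
Proof. exact: tnDr. Qed.
Lemma btens0r s : btens s 0 = 0.
Proof. exact: tn0r. Qed.
Lemma btens_sum s I (r : seq I) (P : pred I) (F : I -> X) :
  btens s (\sum_(i <- r | P i) F i) = \sum_(i <- r | P i) btens s (F i).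
Proof. exact: tn_sumr. Qed.
Lemma btensZ s r x : btens s (r *: x) = btens (g r * s) x.
Proof. by rewrite /btens tnZr -tnZl. Qed.

Lemma bcm_ind (P : bcm -> Prop) :
    P 0 -> (forall s x z, P z -> P (btens s x + z)) -> forall z, P z.
Proof. exact: (@tens_ind R SM X). Qed.

Fact bcm_scalerDr : right_distributive bcm_scale +%R.
Proof. by move=> s y z; exact: (linearD (tens_map _ _)). Qed.
Fact bcm_scale0 s : bcm_scale s 0 = 0.
Proof. exact: (linear0 (tens_map _ _)). Qed.
Fact bcm_scalerA s t z : bcm_scale s (bcm_scale t z) = bcm_scale (s * t) z.
Proof.
elim/bcm_ind: z => [|t' x z IH]; first by rewrite !bcm_scale0.
by rewrite !bcm_scalerDr IH !bcm_scale_tn mulrA.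
Qed.
Fact bcm_scale1r : left_id 1 bcm_scale.
Proof.
move=> z; elim/bcm_ind: z => [|t x z IH]; first exact: bcm_scale0.
by rewrite bcm_scalerDr IH bcm_scale_tn mul1r.
Qed.
Fact bcm_scalerDl z : {morph bcm_scale^~ z : s t / s + t}.
Proof.
move=> s t; elim/bcm_ind: z => [|t' x z IH]; first by rewrite !bcm_scale0 addr0.
by rewrite !bcm_scalerDr IH !bcm_scale_tn mulrDl btensDl addrACA.
Qed.
HB.instance Definition _ := GRing.Zmodule_isLmodule.Build S bcm
  bcm_scalerA bcm_scale1r bcm_scalerDr bcm_scalerDl.

Lemma btens_scale s t x : s *: btens t x = btens (s * t) x.
Proof. exact: bcm_scale_tn. Qed.
End Scaling.

Section Map.
Variables (X Y : lmodType R) (u : {linear X -> Y}).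
Definition bcm_map (z : bcm X) : bcm Y := tens_map (@idfun SM) u z.
Lemma bcm_map_tn s x : bcm_map (btens s x) = btens s (u x).
Proof. exact: tens_map_tn. Qed.
Fact bcm_map_linear : linear bcm_map.
Proof.
have mapD y z : bcm_map (y + z) = bcm_map y + bcm_map z.
  exact: (linearD (tens_map _ _)).
have map0 : bcm_map 0 = 0 by exact: (linear0 (tens_map _ _)).
move=> s y z; rewrite mapD; congr (_ + _).
elim/bcm_ind: y => [|t x y IH]; first by rewrite scaler0 map0 scaler0.
by rewrite scalerDr !mapD IH scalerDr btens_scale !bcm_map_tn btens_scale.
Qed.
HB.instance Definition _ :=
  GRing.isLinear.Build S (bcm X) (bcm Y) *:%R bcm_map bcm_map_linear.
End Map.

Lemma bcm_map_comp (X Y Z : lmodType R) (u : {linear X -> Y})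
    (v : {linear Y -> Z}) z :
  bcm_map v (bcm_map u z) = bcm_map (v \o u) z.
Proof.
elim/bcm_ind: z => [|s x z IH]; first by rewrite !linear0.
by rewrite !linearD /= IH !bcm_map_tn.
Qed.

Lemma eq_bcm_map (X Y : lmodType R) (u v : {linear X -> Y}) :
  u =1 v -> bcm_map u =1 bcm_map v.
Proof. by move=> uv; exact: eq_tens_map. Qed.

Lemma bcm_map0 (X Y : lmodType R) (u : {linear X -> Y}) z :
  (forall x, u x = 0) -> bcm_map u z = 0.
Proof.
move=> u0; elim/bcm_ind: z => [|s x z IH]; first by rewrite linear0.
by rewrite linearD /= IH bcm_map_tn u0 btens0r addr0.
Qed.

End BaseChange.
Arguments bcm_map {R S} g {X Y} u z.

Lemma ff_exact (R S : comPzRingType) (g : {rmorphism R -> S}) :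
  faithfully_flat (amod (com_alg g)) ->
  forall (X Y Z : lmodType R) (u : {linear X -> Y}) (v : {linear Y -> Z}),
  exact u v <-> exact (bcm_map g u) (bcm_map g v).
Proof. by move=> gF X Y Z u v; exact: gF. Qed.

Section BaseChangeMapValues.
Variables (R S : comPzRingType) (g : {rmorphism R -> S}) (X Y : lmodType R).
Implicit Types (u v w : {linear X -> Y}) (z : bcm g X).

Lemma bcm_mapD u v w z : (forall x, w x = u x + v x) ->
  bcm_map g w z = bcm_map g u z + bcm_map g v z.
Proof.
move=> wE; elim/bcm_ind: z => [|s x z IH]; first by rewrite !linear0 addr0.
by rewrite !linearD /= IH !bcm_map_tn wE btensDr addrACA.
Qed.
Lemma bcm_mapZ (r : R) u w z : (forall x, w x = r *: u x) ->
  bcm_map g w z = g r *: bcm_map g u z.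
Proof.
move=> wE; elim/bcm_ind: z => [|s x z IH]; first by rewrite !linear0.
by rewrite !linearD /= IH !bcm_map_tn wE btensZ btens_scale.
Qed.
End BaseChangeMapValues.

Lemma bcm_map_scale (R S : comPzRingType) (g : {rmorphism R -> S})
    (X Y : lmodType R) (u : {linear X -> Y}) s (z : bcm g X) :
  bcm_map g u (s *: z) = s *: bcm_map g u z.
Proof. exact: linearZ_LR. Qed.

Lemma bcm_map_id (R S : comPzRingType) (g : {rmorphism R -> S}) (X : lmodType R)
    (u : {linear X -> X}) (z : bcm g X) :
  (forall x, u x = x) -> bcm_map g u z = z.
Proof.
move=> uE; elim/bcm_ind: z => [|s x z IH]; first exact: linear0.
by rewrite linearD /= IH bcm_map_tn uE.
Qed.

(** * Finite presentation and faithfully flat descent of linear systems *)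

Section BaseChangeFP.
Variables (R S : comPzRingType) (g : {rmorphism R -> S}).

Lemma bcm_basis n (z : bcm g 'rV[R]_n) :
  exists x : 'rV[S]_n, comb (fun i => btens g 1 ('e_i : 'rV[R]_n)) x = z.
Proof.
elim/bcm_ind: z => [|s y z [x IH]]; first by exists 0; exact: linear0.
exists (s *: map_mx g y + x); rewrite linearP IH; congr (_ + _).
rewrite {2}[y]row_sum_delta btens_sum combE scaler_sumr.
apply: eq_bigr => i _; rewrite btensZ mxE !btens_scale mulr1.
by rewrite mulrC.
Qed.

(** Finitely many elements of [S (x)_R X] involve only finitely many elements
    of [X].  Allowing every larger list [xs'] lets the lists found for the
    different elements be concatenated. *)
Lemma bcm_span (X : lmodType R) (zs : seq (bcm g X)) :
  exists xs : seq X, forall xs', {subset xs <= xs'} ->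
  forall z, z \in zs -> exists y, bcm_map g (comb (tnth (in_tuple xs'))) y = z.
Proof.
elim: zs => [|z zs [xs0 IH]]; first by exists [::].
suff [xs xsE]: exists xs : seq X, forall xs', {subset xs <= xs'} ->
    exists y, bcm_map g (comb (tnth (in_tuple xs'))) y = z.
  exists (xs ++ xs0) => xs' sub w; rewrite inE => /predU1P[->|wzs].
    by apply: xsE => x xxs; apply: sub; rewrite mem_cat xxs.
  by apply: IH wzs => x xxs; apply: sub; rewrite mem_cat xxs orbT.
elim/bcm_ind: z => [|s x z [xs xsE]].
  by exists [::] => xs' _; exists 0; exact: linear0.
exists (x :: xs) => xs' sub.
have [|y yE] := xsE xs'; first by move=> w wxs; apply: sub; rewrite inE wxs orbT.
have /(tnthP (in_tuple xs'))[i xi] : x \in xs' by apply: sub; rewrite mem_head.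
exists (btens g s ('e_i : 'rV_(size xs')) + y).
by rewrite linearD /= yE bcm_map_tn comb_delta -xi.
Qed.

(** Right exactness of base change.  To see that the kernel of [p'] is the image
    of [u'], map [S (x)_R M] back to the cokernel of [u'] by
    [s (x) p y |-> s y]. *)
Lemma bcm_fp (M : lmodType R) : fp_module M -> fp_module (bcm g M).
Proof.
case=> m [n [u [p [up pS]]]].
pose p' := comb (fun i => btens g 1 (p 'e_i)) : {linear 'rV[S]_n -> _}.
have p'E y : p' (map_mx g y) = btens g 1 (p y).
  rewrite [in RHS](comb_uniq p) !combE btens_sum.
  by apply: eq_bigr => i _; rewrite btensZ mxE btens_scale.
pose u' := comb (fun i => map_mx g (u 'e_i)) : {linear 'rV[S]_m -> 'rV[S]_n}.
have u'E t : map_mx g (u t) = u' (map_mx g t).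
  rewrite [in LHS](comb_uniq u) !combE raddf_sum /=.
  by apply: eq_bigr => i _; rewrite map_mxZ mxE.
have [Z [w u'w]] := exists_coker u'.
pose b (s : amod (com_alg g)) x : Z := (s : S) *: w (map_mx g (projT1 (cid (pS x)))).
have bE s y : b s (p y) = (s : S) *: w (map_mx g y).
  rewrite /b; case: cid => y' /= yy'; congr (_ *: _); apply/eqP.
  rewrite -subr_eq0 -linearB /= -map_mxB; apply/eqP.
  have [t <-] : exists t, u t = y' - y by apply/up; rewrite linearB /= yy' subrr.
  by apply/u'w; exists (map_mx g t); rewrite u'E.
have b_bal : balanced b.
  split=> [s s' x|s x x'|r s x]; first exact: scalerDl.
    have [y <-] := pS x; have [y' <-] := pS x'.
    by rewrite -linearD !bE map_mxD linearD scalerDr.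
  have [y <-] := pS x; rewrite -linearZ !bE map_mxZ linearZ scalerA /=.
  by congr (_ *: _); exact: mulrC.
exists m, n, u', p'; split=> [x|z].
  split=> [E|[t <-]].
    apply/u'w; suff <- : tens_lift b (p' x) = w x by rewrite E; exact: tens_lift0.
    have lift_sum I (r : seq I) F :
        tens_lift b (\sum_(i <- r) F i) = \sum_(i <- r) tens_lift b (F i).
      by apply: big_morph => [y z|]; [exact: tens_liftD | exact: tens_lift0].
    rewrite [in RHS](comb_uniq w) !combE lift_sum; apply: eq_bigr => i _.
    rewrite btens_scale mulr1 (tens_lift_tn b_bal) bE; congr (_ *: w _).
    by rewrite map_delta_mx.
  rewrite [u' t]combE linear_sum big1 // => i _.
  rewrite linearZ_LR p'E.
  have -> : p (u 'e_i) = 0 by apply/up; exists 'e_i.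
  by rewrite btens0r scaler0.
elim/bcm_ind: z => [|s x z [y IH]]; first by exists 0; exact: linear0.
have [x' <-] := pS x; exists (s *: map_mx g x' + y).
by rewrite linearP IH p'E btens_scale mulr1.
Qed.

Hypothesis gF : faithfully_flat (amod (com_alg g)).

(** By flatness, each generator over [S] of the kernel of [S (x) v] is a finite
    sum of tensors [s (x) x] with [x] in the kernel of [v].  The finitely many
    elements [x] that occur generate the kernel after base change, hence, by
    faithful flatness, they generate it over [R]. *)
Lemma span_descent (V M : lmodType R) (v : {linear V -> M}) m
    (w : {linear 'rV[S]_m -> bcm g V}) :
  exact w (bcm_map g v) -> exists n (u : {linear 'rV[R]_n -> V}), exact u v.
Proof.
move=> wv; have [X [i iv]] := exists_ker v.
have /(ff_exact gF) iv' := iv.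
have gen j : exists y, bcm_map g i y = w 'e_j by apply/iv'/wv; exists 'e_j.
pose y j := projT1 (cid (gen j)).
have [xs xsE] := bcm_span [seq y j | j <- enum 'I_m].
have vi x : v (i x) = 0 by apply/iv; exists x.
pose c := comb (tnth (in_tuple xs)).
exists (size xs), (i \o c); apply/(ff_exact gF) => z.
split=> [/wv[x <-]|[x <-]]; last first.
  by rewrite /= bcm_map_comp bcm_map0 // => x'; rewrite /= vi.
have cE j : exists y', bcm_map g c y' = y j.
  by apply: (xsE xs) => //; apply: map_f; rewrite mem_enum.
exists (\sum_j x 0 j *: projT1 (cid (cE j))).
rewrite (comb_uniq w) combE linear_sum; apply: eq_bigr => j _.
rewrite linearZ /= -bcm_map_comp; case: cid => y' /= ->.
by rewrite /y; case: cid => ? /= ->.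
Qed.

(** [span_descent] applies first to the zero map on [M], which yields a finite
    free cover, and then to this cover, whose kernel over [S] is finitely
    generated by [fp_kernel]. *)
Lemma fp_descent (M : lmodType R) : fp_module (bcm g M) -> fp_module M.
Proof.
move=> Mfp; have [m [n [u [p [up pS]]]]] := Mfp.
(* The zero map needs a target; any module does, so M itself is taken. *)
have zL : linear (fun _ : M => 0 : M) by move=> a x y; rewrite scaler0 addr0.
have p0 : exact p (bcm_map g (lin zL)).
  by move=> y; split=> _; [exact: pS | exact: bcm_map0].
have [n' [v v0]] := span_descent p0.
have vS y : exists x, v x = y by apply/v0.
have v'S z : exists x, bcm_map g v x = z.
  elim/bcm_ind: z => [|s x z [y IH]]; first by exists 0; exact: linear0.
  have [x' <-] := vS x; exists (btens g s x' + y).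
  by rewrite linearD /= IH bcm_map_tn.
pose e := comb (fun i => btens g 1 ('e_i : 'rV[R]_n')).
have eS z : exists x, (bcm_map g v \o e) x = z.
  by have [y <-] := v'S z; have [x <-] := bcm_basis y; exists x.
have [m' [t tE]] := fp_kernel Mfp eS.
have tv : exact (e \o t) (bcm_map g v).
  move=> z; split=> [|[x <-]]; last by apply/(tE (t x)); exists x.
  by have [x <-] := bcm_basis z => /(tE x)[y <-]; exists y.
by have [m2 [u2 uv]] := span_descent tv; exists m2, n', u2, v.
Qed.

(** Let [v] be the quotient map of [Y] by the image of [u] and [y].  Over [S],
    [y] already lies in the image of [u], so [u] and [v] form an exact sequence
    there; then they form one over [R], and [v y = 0] puts [y] in the image of
    [u]. *)
Lemma solve_descent (X Y : lmodType R) (u : {linear X -> Y}) y (x0 : bcm g X) :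
  bcm_map g u x0 = btens g 1 y -> exists x, u x = y.
Proof.
move=> x0E.
have wL : linear (fun q : (X * R^o)%type => u q.1 + q.2 *: y).
  move=> a [x r] [x' r'] /=; rewrite linearP scalerDl scalerDr addrACA scalerA.
  by [].
have [Z [v wv]] := exists_coker (lin wL).
have vw q : v (lin wL q) = 0 by apply/wv; exists q.
have vu x : v (u x) = 0.
  by have := vw (x, 0); rewrite linE /= scale0r addr0.
apply/(_ : exact u v); last first.
  by have := vw (0, 1); rewrite linE /= scale1r linear0 add0r.
apply/(ff_exact gF) => z; have /(ff_exact gF) wv' := wv.
split=> [/wv'[t <-]|[x <-]]; last first.
  by rewrite /= bcm_map_comp bcm_map0.
elim/bcm_ind: t => [|s [x r] t [x' IH]]; first by exists 0; rewrite !linear0.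
exists (btens g s x + (s * g r) *: x0 + x').
rewrite !linearD linearZ /= x0E !bcm_map_tn IH linE /= btensDr btensZ.
by rewrite btens_scale mulr1 mulrC.
Qed.

Section System.
Variables (I : finType) (N : lmodType R).

Fact ffun_pr_linear i : linear (fun F : {ffun I -> N} => F i).
Proof. by move=> a F G; rewrite !ffunE. Qed.
Definition ffun_pr i : {linear {ffun I -> N} -> N} := lin (ffun_pr_linear i).
Fact ffun_inj_linear i :
  linear (fun x : N => [ffun j => if j == i then x else 0] : {ffun I -> N}).
Proof.
move=> a x y; apply/ffunP => j; rewrite !ffunE.
by case: (j == i); rewrite // scaler0 addr0.
Qed.
Definition ffun_in i : {linear N -> {ffun I -> N}} := lin (ffun_inj_linear i).

Lemma ffun_pr_in i j x : ffun_pr i (ffun_in j x) = if i == j then x else 0.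
Proof. by rewrite !linE ffunE. Qed.

(** Base change commutes with finite products: this is what restricts
    [system_descent] to finitely many equations. *)
Lemma bcm_ffun_sum (z : bcm g {ffun I -> N}) :
  z = \sum_i bcm_map g (ffun_in i) (bcm_map g (ffun_pr i) z).
Proof.
elim/bcm_ind: z => [|s F z {1}->].
  by rewrite big1 // => i _; rewrite !linear0.
under [RHS]eq_bigr => i _ do rewrite !linearD /= !bcm_map_tn.
rewrite big_split /= -btens_sum; congr (btens g s _ + _).
apply/ffunP => i; rewrite sum_ffunE (bigD1 i) //= big1 => [|j ji].
  by rewrite ffunE eqxx addr0.
by rewrite ffunE eq_sym (negPf ji).
Qed.

Lemma bcm_ffun_ext (z z' : bcm g {ffun I -> N}) :
  (forall i, bcm_map g (ffun_pr i) z = bcm_map g (ffun_pr i) z') -> z = z'.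
Proof.
move=> E; rewrite [z]bcm_ffun_sum [z']bcm_ffun_sum.
by apply: eq_bigr => i _; rewrite E.
Qed.

Lemma bcm_ffun_tuple (x : I -> bcm g N) :
  exists z, forall i, bcm_map g (ffun_pr i) z = x i.
Proof.
exists (\sum_j bcm_map g (ffun_in j) (x j)) => i.
rewrite linear_sum (bigD1 i) //= big1 => [|j ji].
  rewrite bcm_map_comp addr0 (eq_bcm_map (v := idfun)) => [|y].
    elim/bcm_ind: (x i) => [|s y z IH]; first exact: linear0.
    by rewrite linearD /= IH bcm_map_tn.
  by have := ffun_pr_in i i y; rewrite eqxx.
rewrite bcm_map_comp bcm_map0 // => y.
by have := ffun_pr_in i j y; rewrite eq_sym (negPf ji).
Qed.

Lemma system_descent (X : lmodType R) (u : I -> {linear X -> N}) (y : I -> N)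
    (x0 : bcm g X) :
  (forall i, bcm_map g (u i) x0 = btens g 1 (y i)) ->
  exists x, forall i, u i x = y i.
Proof.
move=> x0E.
have uL : linear (fun x => [ffun i => u i x] : {ffun I -> N}).
  by move=> a x x'; apply/ffunP => i; rewrite !ffunE linearP.
have [|x xE] := @solve_descent _ _ (lin uL) [ffun i => y i] x0; last first.
  by exists x => i; move/ffunP/(_ i): xE; rewrite !ffunE.
apply: bcm_ffun_ext => i; rewrite bcm_map_comp bcm_map_tn linE ffunE -x0E.
by apply: eq_bcm_map => x; rewrite /= ffunE.
Qed.
End System.
End BaseChangeFP.

(** * Base change of bimodules *)

Lemma lact0l (R : comPzRingType) (B : algebra R) (N : bimod B) (n : N) :
  lact (0 : B) n = 0.
Proof. by apply: (addrI (lact (0 : B) n)); rewrite -lactDl !addr0. Qed.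
Lemma ract0r (R : comPzRingType) (B : algebra R) (N : bimod B) (n : N) :
  ract n (0 : B) = 0.
Proof. by apply: (addrI (ract n (0 : B))); rewrite -ractDr !addr0. Qed.

Section BaseAction.
Variables (R S : comPzRingType) (g : {rmorphism R -> S}).
Variables (B : algebra R) (N : lmodType R) (e : B -> {linear N -> N}).
Hypothesis eD : forall b b' n, e (b + b') n = e b n + e b' n.
Hypothesis eZ : forall r b n, e (alg_map B r * b) n = r *: e b n.

Lemma base_ind (P : base_alg g B -> Prop) :
    P 0 -> (forall b s x, P x -> P (btn g b s + x)) -> forall x, P x.
Proof. exact: (@tens_ring_ind R B (com_alg g)). Qed.

(** The action of [B (x)_R S] on [S (x)_R N] induced by a linear action [e] of
    [B] on [N]; left and right multiplications are both instances. *)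
Definition base_act (x : base_alg g B) (z : bcm g N) : bcm g N :=
  @tens_lift R (amod B) (amod (com_alg g)) (bcm g N)
    (fun b s => (s : S) *: bcm_map g (e b) z) x.

Lemma base_act_balanced z : @balanced R (amod B) (amod (com_alg g)) (bcm g N)
  (fun b s => (s : S) *: bcm_map g (e b) z).
Proof.
split=> [b b' s|b s s'|r b s].
- by rewrite -scalerDr -(bcm_mapD z (eD b b')).
- exact: scalerDl.
- rewrite (bcm_mapZ z (eZ r b)) scalerA; congr (_ *: _); exact: mulrC.
Qed.

Lemma base_act_btn b s z : base_act (btn g b s) z = s *: bcm_map g (e b) z.
Proof. exact/tens_lift_tn/base_act_balanced. Qed.
Lemma base_actDl x y z : base_act (x + y) z = base_act x z + base_act y z.
Proof. exact/tens_liftD/base_act_balanced. Qed.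
Lemma base_act0l z : base_act 0 z = 0.
Proof. exact/tens_lift0/base_act_balanced. Qed.
Lemma base_actDr x z z' : base_act x (z + z') = base_act x z + base_act x z'.
Proof.
elim/base_ind: x => [|b s x IH]; first by rewrite !base_act0l addr0.
by rewrite !base_actDl IH !base_act_btn linearD scalerDr addrACA.
Qed.
Lemma base_act0r x : base_act x 0 = 0.
Proof. by apply: (addrI (base_act x 0)); rewrite -base_actDr !addr0. Qed.
Lemma base_act_scal s z : (forall n, e 1 n = n) -> base_act (base_map g B s) z = s *: z.
Proof. by move=> e1; rewrite base_act_btn bcm_map_id. Qed.
End BaseAction.

Section BaseChangeBimod.
Variables (R S : comPzRingType) (g : {rmorphism R -> S}).
Variables (B : algebra R) (N : bimod B).

Definition lmap (b : B) : {linear N -> N} := lact_map b.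
Definition rmap (b : B) : {linear N -> N} := ract_map b.
Lemma lmapD b b' n : lmap (b + b') n = lmap b n + lmap b' n.
Proof. exact: lactDl. Qed.
Lemma rmapD b b' n : rmap (b + b') n = rmap b n + rmap b' n.
Proof. exact: ractDr. Qed.
Lemma lmapZ r b n : lmap (alg_map B r * b) n = r *: lmap b n.
Proof. by rewrite [LHS]lactA lact_scal. Qed.
Lemma rmapZ r b n : rmap (alg_map B r * b) n = r *: rmap b n.
Proof. by rewrite [LHS]ractA ract_scal ractZ. Qed.
Lemma lmap1 n : lmap 1 n = n.
Proof. by rewrite -(rmorph1 (alg_map B)) [LHS]lact_scal scale1r. Qed.
Lemma rmap1 n : rmap 1 n = n.
Proof. by rewrite -(rmorph1 (alg_map B)) [LHS]ract_scal scale1r. Qed.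

Lemma btnM b b' s s' :
  btn g b s * btn g b' s' = btn g (b * b') (s * s') :> base_alg g B.
Proof. exact: (@tnrM R B (com_alg g)). Qed.

Local Notation bcN := (bcm g N).
Local Notation BS := (base_alg g B).
Definition bc_lact (x : BS) (z : bcN) : bcN := base_act lmap x z.
Definition bc_ract (z : bcN) (x : BS) : bcN := base_act rmap x z.

Lemma bc_lact_btn b s z : bc_lact (btn g b s) z = s *: bcm_map g (lmap b) z.
Proof. exact: (base_act_btn lmapD lmapZ). Qed.
Lemma bc_ract_btn b s z : bc_ract z (btn g b s) = s *: bcm_map g (rmap b) z.
Proof. exact: (base_act_btn rmapD rmapZ). Qed.
Lemma bc_lact0 z : bc_lact 0 z = 0.
Proof. exact: (base_act0l lmapD lmapZ). Qed.
Lemma bc_ract0 z : bc_ract z 0 = 0.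
Proof. exact: (base_act0l rmapD rmapZ). Qed.
Lemma bc_lactr0 x : bc_lact x 0 = 0.
Proof. exact: (base_act0r lmapD lmapZ). Qed.
Lemma bc_ractr0 x : bc_ract 0 x = 0.
Proof. exact: (base_act0r rmapD rmapZ). Qed.
Fact bc_lactDl x y z : bc_lact (x + y) z = bc_lact x z + bc_lact y z.
Proof. exact: (base_actDl lmapD lmapZ). Qed.
Fact bc_ractDr z x y : bc_ract z (x + y) = bc_ract z x + bc_ract z y.
Proof. exact: (base_actDl rmapD rmapZ). Qed.
Fact bc_lactDr x y z : bc_lact x (y + z) = bc_lact x y + bc_lact x z.
Proof. exact: (base_actDr lmapD lmapZ). Qed.
Fact bc_ractDl y z x : bc_ract (y + z) x = bc_ract y x + bc_ract z x.
Proof. exact: (base_actDr rmapD rmapZ). Qed.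
Fact bc_lact_scal s z : bc_lact (alg_map BS s) z = s *: z.
Proof. exact: (base_act_scal lmapD lmapZ s z lmap1). Qed.
Fact bc_ract_scal s z : bc_ract z (alg_map BS s) = s *: z.
Proof. exact: (base_act_scal rmapD rmapZ s z rmap1). Qed.

Fact bc_lactA x y z : bc_lact (x * y) z = bc_lact x (bc_lact y z).
Proof.
elim/base_ind: x => [|b s x IH]; first by rewrite mul0r !bc_lact0.
rewrite mulrDl !bc_lactDl IH; congr (_ + _).
elim/base_ind: y {IH} => [|b' s' y IH].
  by rewrite mulr0 !bc_lact0 bc_lactr0.
rewrite mulrDr !bc_lactDl bc_lactDr IH btnM !bc_lact_btn bcm_map_scale scalerA.
congr (_ *: _ + _); rewrite bcm_map_comp.
by apply: eq_bcm_map => m; exact: lactA.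
Qed.
Fact bc_ractA z x y : bc_ract z (x * y) = bc_ract (bc_ract z x) y.
Proof.
elim/base_ind: x => [|b s x IH]; first by rewrite mul0r !bc_ract0 bc_ractr0.
rewrite mulrDl !bc_ractDr bc_ractDl IH; congr (_ + _).
elim/base_ind: y {IH} => [|b' s' y IH]; first by rewrite mulr0 !bc_ract0.
rewrite mulrDr !bc_ractDr IH btnM !bc_ract_btn bcm_map_scale scalerA mulrC.
congr (_ *: _ + _); rewrite bcm_map_comp.
by apply: eq_bcm_map => m; exact: ractA.
Qed.
Fact bc_lractA x z y : bc_ract (bc_lact x z) y = bc_lact x (bc_ract z y).
Proof.
elim/base_ind: x => [|b s x IH]; first by rewrite !bc_lact0 bc_ractr0.
rewrite !bc_lactDl bc_ractDl IH; congr (_ + _).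
elim/base_ind: y {IH} => [|b' s' y IH]; first by rewrite !bc_ract0 bc_lactr0.
rewrite !bc_ractDr bc_lactDr IH !(bc_lact_btn, bc_ract_btn).
rewrite !bcm_map_scale !scalerA [s' * s]mulrC; congr (_ *: _ + _).
rewrite !bcm_map_comp.
by apply: eq_bcm_map => m; exact: lractA.
Qed.

Definition bc_bimod : bimod BS :=
  @Bimod S BS bcN bc_lact bc_ract bc_lactDl bc_lactDr bc_ractDl bc_ractDr
    bc_lactA bc_ractA bc_lractA bc_lact_scal bc_ract_scal.

Lemma bc_lact1 b z : bc_lact (btn g b 1) z = bcm_map g (lmap b) z.
Proof. by rewrite bc_lact_btn scale1r. Qed.
Lemma bc_ract1 b z : bc_ract z (btn g b 1) = bcm_map g (rmap b) z.
Proof. by rewrite bc_ract_btn scale1r. Qed.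
Lemma bc_lact_tens b s t n :
  bc_lact (btn g b s) (btens g t n) = btens g (s * t) (lact b n).
Proof. by rewrite bc_lact_btn bcm_map_tn btens_scale. Qed.
Lemma bc_ract_tens b s t n :
  bc_ract (btens g t n) (btn g b s) = btens g (s * t) (ract n b).
Proof. by rewrite bc_ract_btn bcm_map_tn btens_scale. Qed.
End BaseChangeBimod.

Section PullBimod.
Variables (S : comPzRingType) (A C : algebra S) (h : {rmorphism A -> C}).
Hypothesis h_alg : forall s, h (alg_map A s) = alg_map C s.
Variable M : bimod C.

Definition pull_bimod : bimod A.
Proof.
apply: (@Bimod S A M (fun a m => lact (h a) m) (fun m a => ract m (h a))).
- by move=> a a' m; rewrite rmorphD lactDl.
- by move=> a m m'; exact: lactDr.
- by move=> m m' a; exact: ractDl.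
- by move=> m a a'; rewrite rmorphD ractDr.
- by move=> a a' m; rewrite rmorphM lactA.
- by move=> m a a'; rewrite rmorphM ractA.
- by move=> a m a'; exact: lractA.
- by move=> s m; rewrite h_alg lact_scal.
- by move=> s m; rewrite h_alg ract_scal.
Defined.
End PullBimod.

Section SwapIso.
Variables (R S : comPzRingType) (g : {rmorphism R -> S}) (B : algebra R).

Lemma bcm_base_iso : lmod_iso (bcm g (amod B)) (amod (base_alg g B)).
Proof.
pose to (s : amod (com_alg g)) (b : amod B) : amod (base_alg g B) := btn g b s.
pose fro (b : amod B) (s : amod (com_alg g)) : bcm g (amod B) := btens g s b.
have to_bal : balanced to.
  split=> [s s' b|s b b'|r s b]; last by rewrite /to /btn /tnr tnZr tnZl.
    exact: (@tnrDr R B (com_alg g)).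
  exact: (@tnrDl R B (com_alg g)).
have fro_bal : balanced fro.
  split=> [b b' s|b s s'|r b s]; last by rewrite /fro /btens tnZr tnZl.
    exact: btensDr.
  exact: btensDl.
pose p (z : bcm g (amod B)) : amod (base_alg g B) := tens_lift to z.
pose q (x : amod (base_alg g B)) : bcm g (amod B) := tens_lift fro x.
have pE s b : p (btens g s b) = btn g b s by exact: (tens_lift_tn to_bal).
have qE s b : q (btn g b s) = btens g s (b : amod B) by exact: (tens_lift_tn fro_bal).
have pD y z : p (y + z) = p y + p z by exact: (tens_liftD to_bal).
have qD y z : q (y + z) = q y + q z by exact: (tens_liftD fro_bal).
have p0 : p 0 = 0 by exact: (tens_lift0 to_bal).
have q0 : q 0 = 0 by exact: (tens_lift0 fro_bal).
have pL : linear p.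
  move=> t y z; rewrite pD; congr (_ + _).
  elim/bcm_ind: y => [|s b y IH]; first by rewrite scaler0 p0 scaler0.
  rewrite scalerDr !pD IH scalerDr btens_scale !pE; congr (_ + _).
  by rewrite -[RHS]/(btn g 1 t * btn g b s : base_alg g B) btnM mul1r.
exists (lin pL), q => [z|x]; rewrite linE.
  elim/bcm_ind: z => [|s b z IH]; first by rewrite p0.
  by rewrite pD qD IH pE qE.
elim/base_ind: x => [|b s x IH]; first by rewrite q0.
by rewrite qD pD IH qE pE.
Qed.

(** The [S]-linear extension [b (x) s |-> s (x) d(b)]. *)
Lemma bc_derivation (N : bimod B) (d : amod B -> N) : is_der N d ->
  exists d' : amod (base_alg g B) -> bc_bimod g N, is_der (bc_bimod g N) d' /\
    forall b s, d' (btn g b s) = btens g s (d b).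
Proof.
case=> dL dM.
pose c (b : amod B) (s : amod (com_alg g)) : bcm g N := btens g s (lin dL b).
have c_bal : balanced c.
  split=> [b b' s|b s s'|r b s].
  - by rewrite /c linearD btensDr.
  - exact: btensDl.
  - by rewrite /c linearZ /= /btens tnZr tnZl.
pose e (x : amod (base_alg g B)) : bc_bimod g N := tens_lift c x.
have eE b s : e (btn g b s) = btens g s (d b) by exact: (tens_lift_tn c_bal).
have eD x y : e (x + y) = e x + e y by exact: (tens_liftD c_bal).
have e0 : e 0 = 0 by exact: (tens_lift0 c_bal).
exists e; split=> //; split=> [t x y|x y].
  rewrite eD; congr (_ + _).
  elim/base_ind: x => [|b s x IH]; first by rewrite scaler0 e0 scaler0.
  rewrite scalerDr !eD IH scalerDr eE; congr (_ + _).
  rewrite -[t *: _]/(btn g 1 t * btn g b s : base_alg g B) btnM mul1r eE.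
  by rewrite [RHS]btens_scale.
elim/base_ind: x => [|b s x IH].
  by rewrite mul0r e0 ract0 add0r; exact/esym/lact0l.
rewrite mulrDl !eD IH ractDl lactDl addrACA; congr (_ + _).
elim/base_ind: y {x IH} => [|b' s' y IH].
  by rewrite mulr0 e0 lact0 addr0; exact/esym/ract0r.
rewrite mulrDr !eD IH ractDr lactDr addrACA; congr (_ + _).
rewrite btnM !eE dM btensDr; congr (_ + _).
  by rewrite mulrC; exact/esym/bc_ract_tens.
exact/esym/bc_lact_tens.
Qed.
End SwapIso.

(** * Derivations of separable algebras *)

Section Separable.
Variables (k : comPzRingType) (A : algebra k).

(** Apply projectivity of [A] to the multiplication map from the enveloping
    algebra to [A]; the section sends [1] to [e]. *)
Lemma separable_idempotent : separable A -> exists e : env_alg A,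
  env_scale e 1 = 1 /\
  forall a : A, @tnr k A (op_alg A) a 1 * e = @tnr k A (op_alg A) 1 a * e.
Proof.
move=> sepA.
have pL : linear (fun z : (env_alg A)^o => z *: (1 : env_mod A)).
  by move=> z x y; rewrite scalerDl scalerA.
have pS y : exists x, lin pL x = y.
  exists (@tnr k A (op_alg A) y 1); rewrite linE.
  by rewrite [LHS]env_scale_tn !mulr1.
have [l lE] := sepA _ _ (lin pL) (@idfun (env_mod A)) pS.
exists (l 1); split=> [|a]; first exact: (lE 1).
rewrite -[LHS](linearZ_LR l) -[RHS](linearZ_LR l); congr (l _).
rewrite -[LHS]/(env_scale _ _) -[RHS]/(env_scale _ _) !env_scale_tn.
by rewrite !mulr1 mul1r.
Qed.

(** For [e = sum x_i (x) y_i], the element [n = sum x_i d(y_i)] satisfies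
    [a n = sum x_i d(y_i a) = n a + d(a)]. *)
Lemma separable_inner (M : bimod A) (d : amod A -> M) :
  separable A -> is_der M d -> is_inner M d.
Proof.
move=> /separable_idempotent[e [e1 eC]] [dL dM].
pose b (x : amod A) (y : amod (op_alg A)) : M := lact (x : A) (d y).
have dD x y : d (x + y) = d x + d y by have := dL 1 x y; rewrite !scale1r.
have b_bal : balanced b.
  split=> [x x' y|x y y'|z x y]; first exact: lactDl.
    by rewrite /b -lactDr; congr lact; exact: dD.
  have E : d (z *: (y : amod (op_alg A))) = z *: d y.
    have d0 : d 0 = 0 by apply: (addrI (d 0)); rewrite -dD !addr0.
    rewrite -[RHS]addr0 -d0 -dL addr0; congr d; symmetry; exact: alg_mapC.
  by rewrite /b E lactZ -lact_scal -lactA.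
pose T := tens_lift b : env_alg A -> M.
have TD z z' : T (z + z') = T z + T z' by exact: tens_liftD.
have T0 : T 0 = 0 by exact: tens_lift0.
have TE x y : T (@tnr k A (op_alg A) x y) = lact (x : A) (d y) by exact: tens_lift_tn.
have Tl a z : T (@tnr k A (op_alg A) a 1 * z) = lact a (T z).
  elim/(@tens_ring_ind k A (op_alg A)): z => [|x y z IH].
    by rewrite mulr0 T0 lact0.
  rewrite mulrDr !TD IH lactDr tnrM !TE -lactA; congr (lact _ (d _) + _).
  exact: (@mulr1 A).
have Tr a z : T (@tnr k A (op_alg A) 1 a * z) =
    ract (T z) a + lact (env_scale z 1 : A) (d a).
  elim/(@tens_ring_ind k A (op_alg A)): z => [|x y z IH].
    rewrite mulr0 T0 env_scale0 ract0 add0r; apply: (addrI (lact (0 : A) (d a))).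
    by rewrite -lactDl !addr0.
  rewrite mulrDr !TD IH tnrM !TE ractDl env_scalerDl lactDl addrACA.
  congr (_ + _); rewrite env_scale_tn mul1r mulr1.
  by rewrite [X in d X](_ : _ = (y : A) * a) // dM lactDr lractA lactA.
exists (T e) => a; have := Tr a e.
by rewrite -eC Tl e1 => ->; rewrite addrC addKr [RHS]lmap1.
Qed.
End Separable.

Section BaseChangeInner.
Variables (k S : comPzRingType) (h : {rmorphism k -> S}) (A : algebra k).

Definition base_incl (a : A) : restr_alg h (base_alg h A) := btn h a 1.
Fact base_incl_additive : zmod_morphism base_incl.
Proof.
move=> a b; apply/eqP; rewrite eq_sym subr_eq; apply/eqP.
by rewrite -[RHS](@tnrDl k A (com_alg h)) subrK.
Qed.
Fact base_incl_monoid : monoid_morphism base_incl.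
Proof. by split=> // a b; rewrite [RHS](@tnrM k A (com_alg h)) mulr1. Qed.
HB.instance Definition _ := GRing.isZmodMorphism.Build A
  (restr_alg h (base_alg h A)) base_incl base_incl_additive.
HB.instance Definition _ := GRing.isMonoidMorphism.Build A
  (restr_alg h (base_alg h A)) base_incl base_incl_monoid.

Lemma base_incl_alg z :
  base_incl (alg_map A z) = alg_map (restr_alg h (base_alg h A)) z.
Proof.
have := @tnrZ k A (com_alg h) z 1 1; rewrite mulr1 => E.
rewrite [LHS]E; congr (btn h 1 _); exact: mulr1.
Qed.

Lemma btn_scale a s : btn h a s = s *: (base_incl a : amod (base_alg h A)).
Proof.
rewrite -[RHS]/(btn h 1 s * btn h a 1 : base_alg h A).
by rewrite btnM mul1r mulr1.
Qed.

(** The restriction to [A] is a derivation of a separable algebra, hence the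
    inner derivation of some [n], and both sides are [S]-linear. *)
Lemma base_separable_inner (M : bimod (base_alg h A)) (d : amod (base_alg h A) -> M) :
  separable A -> is_der M d -> is_inner M d.
Proof.
move=> sepA [dL dM].
have dD x y : d (x + y) = d x + d y by have := dL 1 x y; rewrite !scale1r.
have d0 : d 0 = 0 by apply: (addrI (d 0)); rewrite -dD !addr0.
have dZ s x : d (s *: x) = s *: d x by rewrite -[s *: x]addr0 dL d0 addr0.
pose M0 := pull_bimod base_incl_alg (restr_bimod h M).
have /(separable_inner sepA)[n nE] : is_der M0 (fun a => d (base_incl a)).
  split=> [z x y|x y]; last by rewrite rmorphM dM.
  rewrite -[RHS]/(h z *: d (base_incl x) + d (base_incl y)) -dL; congr d.
  rewrite rmorphD; congr (_ + _).
  by rewrite -[z *: x]/(alg_map A z * (x : A)) [LHS]rmorphM /= base_incl_alg.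
exists n => x; elim/base_ind: x => [|a s x IH].
  by rewrite d0 [lact _ _]lact0l [ract _ _]ract0r subr0.
rewrite dD IH lactDl ractDr opprD addrACA; congr (_ + _).
rewrite btn_scale dZ nE scalerBr; congr (_ - _).
  by rewrite [RHS]lactA lact_scal.
by rewrite [RHS]ractA ract_scal ractZ.
Qed.
End BaseChangeInner.

(** * Derivations along etale homomorphisms *)

(** Derivations of [R] into an [S]-module along [g]. *)
Definition derivation (R S : comPzRingType) (g : {rmorphism R -> S})
    (T : lmodType S) (D : R -> T) : Prop :=
  (forall r r', D (r + r') = D r + D r') /\
  forall r r', D (r * r') = g r *: D r' + g r' *: D r.

Section TrivialExtension.
Variables (S : comPzRingType) (T : lmodType S).

(** The square-zero extension [S (+) T] of [S]: the ring homomorphisms into it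
    that lift a given one into [S] are the derivations into [T]. *)
Definition triv_ext : Type := (S * T)%type.
HB.instance Definition _ := GRing.Zmodule.on triv_ext.
Definition triv_mul (x y : triv_ext) : triv_ext :=
  (x.1 * y.1, x.1 *: y.2 + y.1 *: x.2).
Fact triv_mulA : associative triv_mul.
Proof.
move=> [s m] [t n] [u p]; rewrite /triv_mul /= mulrA; congr pair.
by rewrite !scalerDr !scalerA -addrA [u * s]mulrC [u * t]mulrC.
Qed.
Fact triv_mulC : commutative triv_mul.
Proof. by move=> [s m] [t n]; rewrite /triv_mul /= mulrC addrC. Qed.
Fact triv_mul1 : left_id ((1, 0) : triv_ext) triv_mul.
Proof.
by move=> [s m]; rewrite /triv_mul /= mul1r scale1r scaler0 addr0.
Qed.
Fact triv_mulDl : left_distributive triv_mul +%R.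
Proof.
move=> [s m] [t n] [u p]; rewrite /triv_mul /= mulrDl; congr pair.
by rewrite scalerDl scalerDr addrACA.
Qed.
HB.instance Definition _ := GRing.Zmodule_isComPzRing.Build triv_ext
  triv_mulA triv_mulC triv_mul1 triv_mulDl.

Definition triv_proj (x : triv_ext) : S := x.1.
Fact triv_proj_additive : zmod_morphism triv_proj. Proof. by []. Qed.
Fact triv_proj_monoid : monoid_morphism triv_proj. Proof. by []. Qed.
HB.instance Definition _ :=
  GRing.isZmodMorphism.Build triv_ext S triv_proj triv_proj_additive.
HB.instance Definition _ :=
  GRing.isMonoidMorphism.Build triv_ext S triv_proj triv_proj_monoid.

Section Lift.
Variables (R : comPzRingType) (g : {rmorphism R -> S}) (D : R -> T).
Hypothesis D_der : derivation g D.

Definition triv_lift of derivation g D := fun r => (g r, D r) : triv_ext.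
Local Notation lift := (triv_lift D_der).
Fact triv_lift_additive : zmod_morphism lift.
Proof.
move=> r r'; apply/eqP; rewrite eq_sym subr_eq; apply/eqP.
by rewrite -[RHS]/(g _ + g _, D _ + D _) -D_der.1 -rmorphD subrK.
Qed.
Fact triv_lift_monoid : monoid_morphism lift.
Proof.
have D1 : D 1 = 0.
  apply: (addrI (D 1)); rewrite addr0 -[in RHS](mulr1 1) D_der.2 rmorph1.
  by rewrite !scale1r.
split=> [|r r']; first by rewrite /triv_lift D1 rmorph1.
by rewrite /triv_lift D_der.2 rmorphM.
Qed.
HB.instance Definition _ :=
  GRing.isZmodMorphism.Build R triv_ext lift triv_lift_additive.
HB.instance Definition _ :=
  GRing.isMonoidMorphism.Build R triv_ext lift triv_lift_monoid.
Definition triv_lift_rmorph : {rmorphism R -> triv_ext} := lift.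
End Lift.

(** A derivation [D] along [g] is a lift of [g] to the square-zero extension;
    formal etaleness of [g] lifts the identity of [S] compatibly with it, in
    exactly one way. *)
Lemma etale_derivation (R : comPzRingType) (g : {rmorphism R -> S}) (D : R -> T) :
  formally_etale g -> derivation g D ->
  exists E : S -> T, [/\ derivation idfun E, forall r, E (g r) = D r &
    forall E', derivation idfun E' -> (forall r, E' (g r) = D r) -> E' =1 E].
Proof.
move=> gE D_der.
have pS (y : S) : exists x : triv_ext, triv_proj x = y by exists (y, 0).
have pN (x y : triv_ext) : triv_proj x = 0 -> triv_proj y = 0 -> x * y = 0.
  case: x y => [s m] [t n] E E'; rewrite -[LHS]/(triv_mul _ _) /triv_mul /=.
  by rewrite (E : s = 0) (E' : t = 0) mul0r !scale0r addr0.
have [l [lE lg lU]] := gE _ _ triv_proj (triv_lift_rmorph D_der) idfun pS pN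
  (fun=> erefl).
exists (fun s => (l s).2).
have l1 s : (l s).1 = s by exact: lE.
split=> [||E' E'D E'g].
- split=> s t; first by rewrite rmorphD.
  by rewrite rmorphM /= -[LHS]/(_ + _) !l1.
- by move=> r; rewrite lg.
- by move=> s; rewrite -(lU (triv_lift_rmorph E'D)) // => r; rewrite /= /triv_lift E'g.
Qed.
End TrivialExtension.

Section ExtendToBase.
Variables (k S : comPzRingType) (h : {rmorphism k -> S}) (A : algebra k).
Variables (M : bimod (base_alg h A)) (D : S -> M).
Hypotheses (D_der : derivation idfun D) (Dk : forall z, D (h z) = 0).
Hypothesis DC : forall x s, lact x (D s) = ract (D s) x.

(** The extension is [a (x) s |-> a D(s)], which is balanced because [D]
    vanishes on the image of [k]; the Leibniz rule uses that the values of [D]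
    commute with [A (x)_k S]. *)
Lemma base_extend_derivation : exists d : base_alg h A -> M,
  [/\ forall x y, d (x + y) = d x + d y,
      forall x y, d (x * y) = ract (d x) y + lact x (d y) &
      forall s, d (alg_map (base_alg h A) s) = D s].
Proof.
pose b (a : amod A) (s : amod (com_alg h)) : M := lact (btn h a 1 : base_alg h A) (D s).
have b_bal : balanced b.
  split=> [a a' s|a s s'|z a s].
  - by rewrite /b -lactDl -(@tnrDl k A (com_alg h)).
  - by rewrite /b -lactDr -D_der.1.
  - rewrite /b -[z *: s]/(h z * (s : S)) D_der.2 Dk scaler0 addr0 -lact_scal.
    rewrite -lactA; congr lact; rewrite -[RHS]/(btn h a 1 * btn h 1 (h z)).
    rewrite btnM mulr1 mul1r -[z *: a]/(alg_map A z * a).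
    by rewrite [LHS](@tnrZ k A (com_alg h)); congr (btn h a _); exact: mulr1.
exists (tens_lift b); have dE a s : tens_lift b (btn h a s) = lact (btn h a 1 : base_alg h A) (D s).
  exact: (tens_lift_tn b_bal).
have dD x y : tens_lift b (x + y) = tens_lift b x + tens_lift b y.
  exact: (tens_liftD b_bal).
have d0 : tens_lift b 0 = 0 by exact: (tens_lift0 b_bal).
split=> // [x y|s]; last by rewrite [LHS]dE [LHS]lmap1.
elim/base_ind: x => [|a s x IH].
  rewrite mul0r d0 ract0 add0r; exact/esym/lact0l.
rewrite mulrDl !dD IH ractDl lactDl addrACA; congr (_ + _).
elim/base_ind: y {x IH} => [|a' s' y IH].
  rewrite mulr0 d0 lact0 addr0; exact/esym/ract0r.
rewrite mulrDr !dD IH ractDr lactDr addrACA; congr (_ + _).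
rewrite btnM !dE D_der.2 lactDr addrC lractA -DC -!lactA !btnM mul1r mulr1 /=.
by congr (_ + _); rewrite -lact_scal -lactA -[alg_map _ _]/(btn h 1 _) btnM mul1r mulr1.
Qed.
End ExtendToBase.

(** * Forms: linear derivations are inner *)

Section FormTheory.
Variables (k R S : comPzRingType).
Variables (f : {rmorphism k -> R}) (g : {rmorphism R -> S}) (A : algebra k).
Variable B : subalgebra (AS_R f g A).
Local Notation AS := (AS f g A).
Hypothesis B_form : is_form B.

Lemma form_inverse : exists psi : {rmorphism AS -> base_alg g B},
  [/\ forall s, psi (alg_map AS s) = alg_map (base_alg g B) s,
      forall b : B, psi (subalg_val b) = btn g b 1 & bijective psi].
Proof.
have [phi [[phiA [psi phiK psiK]] phiE]] := B_form.
have psi_add : zmod_morphism psi.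
  by move=> x y; apply: (can_inj phiK); rewrite rmorphB !psiK.
have psi_mon : monoid_morphism psi.
  split=> [|x y]; apply: (can_inj phiK); first by rewrite psiK rmorph1.
  by rewrite rmorphM !psiK.
pose a1 := GRing.isZmodMorphism.Build AS (base_alg g B) psi psi_add.
pose a2 := GRing.isMonoidMorphism.Build AS (base_alg g B) psi psi_mon.
exists (HB.pack_for {rmorphism AS -> base_alg g B} psi a1 a2).
split=> [s|b|]; last by exists phi.
  by apply: (can_inj phiK); rewrite /= psiK phiA.
apply: (can_inj phiK); rewrite [LHS]psiK [RHS]phiE rmorph1.
exact/esym/(@mul1r AS).
Qed.

Hypothesis gF : faithfully_flat (amod (com_alg g)).
Hypothesis A_fp : fp_module (amod A).

(** Over [S], the module [B] becomes [A (x)_k S], which inherits a finite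
    presentation from [A]. *)
Lemma form_fp : fp_module (amod B).
Proof.
apply: (fp_descent gF); have [psi [psiA _ psiB]] := form_inverse.
have psiL : linear (psi : amod AS -> amod (base_alg g B)).
  move=> s x y; rewrite [LHS]rmorphD; congr (_ + _).
  by rewrite -[s *: x]/(alg_map AS s * (x : AS)) [LHS]rmorphM psiA.
apply: fp_iso (lmod_iso_sym (bcm_base_iso g B)) _.
apply: fp_iso (bcm_fp (g \o f) A_fp).
by apply: lmod_iso_trans (bcm_base_iso _ A) _; exists (lin psiL).
Qed.

Hypothesis A_sep : separable A.

(** The extension of [d] to [B (x)_R S], a copy of [A (x)_k S], is inner,
    implemented by some [t] in [S (x)_R N].  So the system
    [b_i n - n b_i = d(b_i)], for generators [b_i] of the [R]-module [B], is
    solvable over [S]; a solution [n] over [R] implements [d]. *)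
Lemma form_inner (N : bimod B) (d : amod B -> N) : is_der N d -> is_inner N d.
Proof.
move=> d_der; have [dL dM] := d_der.
have [psi [psiA psiE _]] := form_inverse.
have [_ [n [_ [v [_ vS]]]]] := form_fp.
have [d' [[d'L d'M] d'E]] := bc_derivation g d_der.
have [|t tE] := @base_separable_inner _ _ _ _ (pull_bimod psiA (bc_bimod g N))
    (fun x => d' (psi x)) A_sep.
  split=> [s x y|x y]; last by rewrite rmorphM d'M.
  rewrite -[RHS]/(s *: (d' (psi x) : bcm g N) + d' (psi y)) -d'L; congr d'.
  rewrite [LHS]rmorphD; congr (_ + _).
  by rewrite -[s *: x]/(alg_map AS s * (x : AS)) [LHS]rmorphM psiA.
have cL (b : B) : linear (fun m : N => lact b m - ract m b).
  move=> r x y; rewrite lactDr ractDl lactZ ractZ opprD addrACA scalerBr.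
  by [].
have [|m mE] := @system_descent _ _ _ gF 'I_n N N (fun i => lin (cL (v 'e_i)))
   (fun i => d (v 'e_i)) t.
  move=> i; have := tE (subalg_val (v 'e_i : B)); rewrite /= psiE d'E => ->.
  rewrite -[RHS]/(bc_lact _ _ - bc_ract _ _) bc_lact1 bc_ract1.
  apply/eqP; rewrite eq_sym subr_eq; apply/eqP.
  by apply: bcm_mapD => x; rewrite linE subrK.
exists m => b; have cmL : linear (fun b : amod B => lact (b : B) m - ract m (b : B)).
  move=> r x y; rewrite lactDl ractDr opprD addrACA scalerBr.
  by rewrite -[r *: x]/(alg_map B r * (x : B)) [lact _ _]lmapZ [ract _ _]rmapZ.
have [x <-] := vS b; rewrite -[LHS]/((lin dL \o v) x) -[RHS]/((lin cmL \o v) x).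
rewrite (comb_uniq (lin dL \o v)) (comb_uniq (lin cmL \o v)) !combE.
by apply: eq_bigr => i _; congr (_ *: _); exact: (esym (mE i)).
Qed.
End FormTheory.

(** * Forms: central derivations of the base extend *)

Section DescendExtension.
Variables (R S : comPzRingType) (g : {rmorphism R -> S}).
Hypothesis gF : faithfully_flat (amod (com_alg g)).
Variables (B : algebra R) (N : bimod B) (D : R -> N).
Hypothesis B_fp : fp_module (amod B).
Hypothesis D_der : derivation idfun D.
Hypothesis DC : forall (b : B) r, lact b (D r) = ract (D r) b.
Variable e : B -> bcm g N.
Hypothesis eD : forall b b', e (b + b') = e b + e b'.
Hypothesis eM : forall b b',
  e (b * b') = bcm_map g (rmap N b') (e b) + bcm_map g (lmap N b) (e b').
Hypothesis eR : forall r, e (alg_map B r) = btens g 1 (D r).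

(** Let [v] present [B] with generators [b i] and relations [u].  An extension
    of [D] with values [F i] at [b i] must send [v x] to [G x], the sum of the
    [D(x_i) b_i + x_i F_i].  This is well defined exactly when [G] vanishes on
    the relations, and it satisfies the Leibniz rule as soon as it does so on
    the products [b i * b j].  Both conditions are linear in [F], and they are
    solved over [S] by the values [e (b i)]. *)
Lemma descend_extension : exists d : B -> N,
  [/\ forall b b', d (b + b') = d b + d b',
      forall b b', d (b * b') = ract (d b) b' + lact b (d b') &
      forall r, d (alg_map B r) = D r].
Proof.
have [m [n [u [v [uv vS]]]]] := B_fp.
pose b i : B := v 'e_i.
have D0 : D 0 = 0 by apply: (addrI (D 0)); rewrite -D_der.1 !addr0.
have D1 : D 1 = 0.
  by apply: (addrI (D 1)); rewrite addr0 -[in RHS](mulr1 1) D_der.2 !scale1r.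
(* F0 and L are the parts of G that are constant and linear in F. *)
pose F0 (x : 'rV[R]_n) : N := \sum_i ract (D (x 0 i)) (b i).
have LL (x : 'rV[R]_n) : linear (fun F : {ffun 'I_n -> N} => \sum_i x 0 i *: F i).
  move=> a F F'; rewrite scaler_sumr -big_split; apply: eq_bigr => i _ /=.
  by rewrite !ffunE scalerDr !scalerA mulrC.
pose L x := lin (LL x).
pose c i j := projT1 (cid (vS (b i * b j))).
have cE i j : v (c i j) = b i * b j by rewrite /c; case: cid.
have ML i j : linear (fun F : {ffun 'I_n -> N} =>
    ract (F i) (b j) + lact (b i) (F j) - L (c i j) F).
  move=> a F F'; rewrite !ffunE ractDl lactDr ractZ lactZ linearP.
  by rewrite addrACA -scalerDr opprD addrACA -scalerBr.
pose eqs (q : 'I_m + 'I_n * 'I_n) : {linear {ffun 'I_n -> N} -> N} :=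
  match q with inl l => L (u 'e_l) | inr ij => lin (ML ij.1 ij.2) end.
pose rhs (q : 'I_m + 'I_n * 'I_n) : N :=
  match q with inl l => - F0 (u 'e_l) | inr ij => F0 (c ij.1 ij.2) end.
have [z0 z0E] := bcm_ffun_tuple (fun i => e (b i)).
have e0 : e 0 = 0 by apply: (addrI (e 0)); rewrite -eD !addr0.
(* That is, e (v x) is G x over S, for F i = e (b i). *)
have LE x : bcm_map g (L x) z0 = e (v x) - btens g 1 (F0 x).
  have -> : bcm_map g (L x) z0 = \sum_i g (x 0 i) *: e (b i).
    under eq_bigr => i _ do rewrite -z0E.
    elim/bcm_ind: {z0E}z0 => [|s F z IH].
      by rewrite linear0 big1 // => i _; rewrite linear0 scaler0.
    rewrite linearD /= IH bcm_map_tn linE btens_sum -big_split.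
    apply: eq_bigr => i _ /=.
    by rewrite linearD /= bcm_map_tn scalerDr btensZ btens_scale.
  have -> : e (v x) = \sum_i e (alg_map B (x 0 i) * b i).
    by rewrite comb_uniq combE; exact: (big_morph e eD e0).
  rewrite /F0 btens_sum -sumrB; apply: eq_bigr => i _.
  rewrite eM eR bcm_map_tn [btens g 1 _ + _]addrC addrK.
  rewrite (bcm_mapZ (r := x 0 i) (u := idfun)) ?bcm_map_id // => y.
  exact: lact_scal.
have [|F FE] := @system_descent _ _ g gF _ N _ eqs rhs z0.
  case=> [l|[i j]] /=.
    have -> : bcm_map g (L (u 'e_l)) z0 = e (v (u 'e_l)) - btens g 1 (F0 (u 'e_l)).
      exact: LE.
    have -> : v (u 'e_l) = 0 by apply/uv; exists 'e_l.
    by rewrite e0 sub0r; apply/eqP; rewrite eq_sym -addr_eq0 -btensDr addNr btens0r.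
  have -> : btens g 1 (F0 (c i j)) = e (v (c i j)) - bcm_map g (L (c i j)) z0.
    by rewrite LE opprB addrC subrK.
  rewrite cE eM -!z0E !bcm_map_comp.
  apply/eqP; rewrite eq_sym subr_eq; apply/eqP.
  have -> : bcm_map g (lin (ML i j)) z0 + bcm_map g (L (c i j)) z0 =
      bcm_map g (lin (ML i j) \+ L (c i j)) z0 by apply/esym/bcm_mapD.
  by apply/esym/bcm_mapD => y; rewrite /= subrK.
pose G x := F0 x + L x F.
have LD x y : L (x + y) F = L x F + L y F.
  by rewrite !linE -big_split; apply: eq_bigr => i _; rewrite mxE scalerDl.
have GD x y : G (x + y) = G x + G y.
  rewrite /G LD addrACA; congr (_ + _); rewrite /F0 -big_split.
  by apply: eq_bigr => i _; rewrite mxE D_der.1 ractDl.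
have GZ r x : G (r *: x) = r *: G x + ract (D r) (v x).
  have -> : ract (D r) (v x) = \sum_i ract (D r) (x 0 i *: v 'e_i).
    rewrite [v x]comb_uniq combE.
    by apply: (big_morph (ract (D r))) => [y y'|]; [exact: ractDr | exact: ract0r].
  rewrite scalerDr addrAC; congr (_ + _).
    rewrite scaler_sumr -big_split; apply: eq_bigr => i _.
    rewrite mxE D_der.2 /= ractDl !ractZ; congr (_ + _).
    by rewrite [RHS]rmapZ.
  by rewrite !linE scaler_sumr; apply: eq_bigr => i _; rewrite mxE scalerA.
have G0 : G 0 = 0 by apply: (addrI (G 0)); rewrite -GD !addr0.
have Gu t : G (u t) = 0.
  rewrite comb_uniq combE (big_morph G GD G0) big1 // => l _.
  have := FE (inl l); rewrite GZ /G => /= ->.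
  have -> : v (u 'e_l) = 0 by apply/uv; exists 'e_l.
  by rewrite subrr scaler0 add0r; exact: ract0r.
have Gv x y : v x = v y -> G x = G y.
  move=> E; have [t tE] : exists t, u t = x - y by apply/uv; rewrite linearB /= E subrr.
  by rewrite -[x](subrK y) GD -tE Gu add0r.
(* d (v x) = G x; the value does not depend on the preimage x, by Gv. *)
pose d (a : amod B) := G (projT1 (cid (vS a))).
have dE x : d (v x) = G x by apply: Gv; case: cid.
have dD a a' : d (a + a') = d a + d a'.
  by have [x <-] := vS a; have [x' <-] := vS a'; rewrite -linearD !dE GD.
have dZ r (a : amod B) : d (r *: a) = r *: d a + ract (D r) (a : B).
  by have [x <-] := vS a; rewrite -linearZ !dE GZ.
have d0 : d 0 = 0 by apply: (addrI (d 0)); rewrite -dD !addr0.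
have db i : d (b i) = F i.
  rewrite /b dE /G /F0 big1 => [|j _].
    by rewrite add0r [LHS]combE -/(comb _ _) [LHS](comb_delta (fun j => F j)).
  by rewrite mxE eqxx /=; case: (j == i); rewrite ?D1 ?D0 ract0.
have dM (a a' : B) : d (a * a') = ract (d a) a' + lact a (d a').
  move: a; apply: (gen_ind vS).
  - by rewrite mul0r d0 ract0 add0r; exact/esym/lact0l.
  - by move=> a c' Ea Ec; rewrite mulrDl !dD Ea Ec ractDl lactDl addrACA.
  - move=> r a Ea.
    have -> : (r *: a : amod B) * a' = (r *: (a * a' : amod B) : amod B).
      exact: esym (@mulrA B _ _ _).
    rewrite !dZ Ea (ractDl (r *: d a)) ractZ -ractA scalerDr addrAC; congr (_ + _).
    by rewrite [RHS]lmapZ.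
  move=> i; move: a'; apply: (gen_ind vS).
  - by rewrite mulr0 d0 lact0 addr0; exact/esym/ract0r.
  - by move=> a c' Ea Ec; rewrite mulrDr !dD Ea Ec ractDr lactDr addrACA.
  - move=> r a Ea.
    have -> : b i * (r *: a : amod B) = (r *: (b i * a : amod B) : amod B).
      by rewrite -[RHS]/(alg_map B r * (b i * a)) mulrA alg_mapC -mulrA.
    rewrite !dZ Ea (lactDr _ (r *: d a)) lactZ scalerDr addrA; congr (_ + _ + _).
      by rewrite [RHS]rmapZ.
    by rewrite ractA -DC lractA.
  move=> j.
  have /eqP : ract (F i) (b j) + lact (b i) (F j) - L (c i j) F = F0 (c i j).
    exact: (FE (inr (i, j))).
  by rewrite subr_eq -cE dE !db => /eqP ->.
exists d; split=> // r.
have d1 : d 1 = 0.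
  apply: (addrI (d 1)); rewrite addr0 -[in RHS](mulr1 1) dM.
  by rewrite [ract _ _]rmap1 [lact _ _]lmap1.
have : d (alg_map B r * 1) = r *: d 1 + ract (D r) 1 := dZ r (1 : B).
by rewrite mulr1 d1 scaler0 add0r => ->; exact: rmap1.
Qed.
End DescendExtension.

Section FormExtension.
Variables (k R S : comPzRingType).
Variables (f : {rmorphism k -> R}) (g : {rmorphism R -> S}) (A : algebra k).
Variable B : subalgebra (AS_R f g A).
Hypotheses (B_form : is_form B) (A_fp : fp_module (amod A)).
Hypotheses (gF : faithfully_flat (amod (com_alg g))) (gE : formally_etale g).

(** Over [S], the derivation extends to [E] on [S] by etaleness.  For [b] in
    [B], the map [s |-> E s + (b E(s) - E(s) b)] extends the same derivation, so
    by uniqueness [b] commutes with the values of [E].  Then [E] extends to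
    [A (x)_k S], and its restriction to [B] is the solution over [S] needed by
    [descend_extension]. *)
Lemma form_extend_derivation (N : bimod B) (D : R -> N) :
    derivation idfun D -> (forall z, D (f z) = 0) ->
    (forall (b : B) r, lact b (D r) = ract (D r) b) ->
  exists d : B -> N,
    [/\ forall b b', d (b + b') = d b + d b',
        forall b b', d (b * b') = ract (d b) b' + lact b (d b') &
        forall r, d (alg_map B r) = D r].
Proof.
move=> D_der Df DC; have [psi [psiA psiE _]] := form_inverse B_form.
have D'_der : derivation g (fun r => btens g 1 (D r)).
  split=> r r'; first by rewrite D_der.1 btensDr.
  by rewrite D_der.2 btensDr !btensZ !btens_scale.
have [E [E_der Eg Euniq]] := etale_derivation gE D'_der.
have EC (b : B) s : bcm_map g (lmap N b) (E s) = bcm_map g (rmap N b) (E s).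
  pose K : {linear bcm g N -> bcm g N} :=
    bcm_map g (lmap N b) \- bcm_map g (rmap N b).
  suff /(_ s)/eqP : (fun t => E t + K (E t)) =1 E.
    by rewrite eq_sym addrC -subr_eq subrr eq_sym subr_eq0 => /eqP.
  apply: Euniq => [|r].
    split=> t t'; first by rewrite E_der.1 (linearD K) addrACA.
    by rewrite E_der.2 (linearD K) !(linearZ_LR K) !scalerDr addrACA.
  have -> : K (E (g r)) = 0 by rewrite /= Eg !bcm_map_tn [lmap _ _ _]DC subrr.
  by rewrite addr0.
have EC' x s : bc_lact x (E s) = bc_ract (E s) x.
  elim/base_ind: x => [|b t x IH]; first by rewrite bc_lact0 bc_ract0.
  by rewrite bc_lactDl bc_ractDr IH bc_lact_btn bc_ract_btn EC.
have [||d [dD dM dE]] := @base_extend_derivation _ _ (g \o f) A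
  (pull_bimod psiA (bc_bimod g N)) E E_der.
- by move=> z; rewrite Eg Df btens0r.
- by move=> x s; exact: EC'.
apply: (@descend_extension _ _ g gF B N D _ D_der DC (fun b => d (subalg_val b))).
- exact: form_fp B_form gF A_fp.
- by move=> b b'; exact: (dD (subalg_val b) (subalg_val b')).
- move=> b b'; rewrite [LHS]dM /= !psiE.
  by congr (_ + _); [exact: bc_ract1 | exact: bc_lact1].
- by move=> r; rewrite [LHS]dE Eg.
Qed.
End FormExtension.

(** * Derivations and centroids *)

Section DerElements.
Variables (R : comPzRingType) (B : algebra R) (N : bimod B).

Lemma der_is_der (d : der N) : is_der N d.
Proof. by case: d => d /= /asboolP. Qed.
Definition mkder (d : amod B -> N) (dP : is_der N d) : der N :=
  @Der R B N d (asboolT dP).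
Lemma derP (d d' : der N) : (forall b, d b = d' b) -> d = d'.
Proof. by move=> E; apply: val_inj; apply: funext. Qed.
Lemma derDE (d d' : der N) b : (d + d') b = d b + d' b.
Proof. exact: (congr1 (fun h => h b) (raddfD val d d')). Qed.
Lemma derZE a (d : der N) b : (a *: d) b = a *: d b.
Proof. exact: (congr1 (fun h => h b) (linearZ_LR val a d)). Qed.
Lemma der0E b : (0 : der N) b = 0.
Proof. by apply: (addrI ((0 : der N) b)); rewrite -derDE !addr0. Qed.
Lemma derD (d : der N) x y : d (x + y) = d x + d y.
Proof. by have := (der_is_der d).1 1 x y; rewrite !scale1r. Qed.
Lemma der0 (d : der N) : d 0 = 0.
Proof. by apply: (addrI (d 0)); rewrite -derD !addr0. Qed.
Lemma derM (d : der N) (x y : B) : d (x * y) = ract (d x) y + lact x (d y).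
Proof. exact: (der_is_der d).2. Qed.
Lemma der1 (d : der N) : d (1 : B) = 0.
Proof.
apply: (addrI (d (1 : B))); rewrite addr0 -[in RHS](mulr1 (1 : B)) derM.
by rewrite [ract _ _]rmap1 [lact _ _]lmap1.
Qed.
Lemma derZ (d : der N) r x : d (r *: x) = r *: d x.
Proof. by have := (der_is_der d).1 r x 0; rewrite !addr0 der0 addr0. Qed.

Lemma inner_is_der (d : amod B -> N) : is_inner N d -> is_der N d.
Proof.
case=> n dE; split=> [r x y|x y].
  rewrite !dE lactDl ractDr opprD addrACA scalerBr.
  by rewrite -[r *: x]/(alg_map B r * (x : B)) [lact _ _]lmapZ [ract _ _]rmapZ.
rewrite !dE lactA ractA; have -> : ract (lact x n - ract n x) y =
    ract (lact x n) y - ract (ract n x) y by exact: (linearB (rmap N y)).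
have -> : lact x (lact y n - ract n y) = lact x (lact y n) - lact x (ract n y).
  exact: (linearB (lmap N x)).
by rewrite lractA [RHS]addrC addrA subrK.
Qed.
End DerElements.

Section BimodIso.
Variables (R : comPzRingType) (B : algebra R) (M N : bimod B).
Variable t : {linear M -> N}.
Hypothesis t_bij : bijective t.
Hypothesis t_lact : forall b m, t (lact b m) = lact b (t m).
Hypothesis t_ract : forall b m, t (ract m b) = ract (t m) b.

Lemma der_post_subproof (d : der M) : is_der N (fun b => t (d b)).
Proof.
split=> [r x y|x y]; first by rewrite (der_is_der d).1 linearP.
by rewrite derM linearD t_ract t_lact.
Qed.
Definition der_post (d : der M) : der N := mkder (der_post_subproof d).
Fact der_post_linear : linear der_post.
Proof.
move=> a d d'; apply: derP => b.
by rewrite derDE derZE -[LHS]/(t ((a *: d + d') b)) derDE derZE linearP.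
Qed.

Lemma der_post_surj (d' : der N) : exists d, der_post d = d'.
Proof.
have [t' tK t'K] := t_bij.
have d_der : is_der M (fun b => t' (d' b)).
  split=> [r x y|x y]; apply: (can_inj tK); rewrite ?linearP ?linearD !t'K.
    exact: (der_is_der d').1.
  by rewrite t_ract t_lact !t'K derM.
by exists (mkder d_der); apply: derP => b; exact: t'K.
Qed.

Lemma der_post_inner d : is_inner N (der_post d) <-> is_inner M d.
Proof.
have [t' tK t'K] := t_bij.
split=> -[n nE].
  exists (t' n) => b; apply: (can_inj tK).
  by rewrite linearB t_lact t_ract t'K; exact: nE.
by exists (t n) => b; rewrite -t_lact -t_ract -linearB -nE.
Qed.

Lemma der_iso : lmod_iso (der M) (der N).
Proof.
exists (lin der_post_linear); apply: bijective_inj_surj; last exact: der_post_surj.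
move=> d d' /(congr1 (fun e : der N => (e : amod B -> N))) E.
apply: derP => b; apply: (bij_inj t_bij).
exact: (congr1 (fun h => h b) E).
Qed.

Lemma HH1_iso : lmod_iso (HH1 M) (HH1 N).
Proof.
have pL : linear (fun d => lquot_pi (@inner_closed R B N) (der_post d)).
  by move=> a d d'; rewrite der_post_linear linearP.
apply: (lquot_iso _ (h := lin pL)) => [w|d]; rewrite ?linE.
  have [d' <-] := lquot_surj w; have [d <-] := der_post_surj d'.
  by exists d.
rewrite lquot_eq0; split=> /asboolP dI; apply/asboolP; exact/der_post_inner.
Qed.
End BimodIso.

Section CenterCentroid.
Variables (k R : comPzRingType) (f : {rmorphism k -> R}) (B : algebra R).
Local Notation Bk := (restr_alg f B).

Lemma centerP (z : center Bk) (b : B) : (center_val z : B) * b = b * center_val z.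
Proof. by case: z => z /= /asboolP zC; exact: zC. Qed.

Lemma center_ctd_subproof (z : center Bk) :
  (fun b : amod Bk => (center_val z : B) * (b : B) : amod B)
    \in ctd_pred (restr_bimod f (reg_bimod B)).
Proof.
apply/asboolP; split=> [a x y|x y].
  rewrite -[RHS]/(alg_map B (f a) * (center_val z * (x : B)) + center_val z * (y : B)).
  rewrite -[a *: x + y]/(alg_map B (f a) * (x : B) + (y : B)) mulrDr.
  by rewrite mulrA -alg_mapC -mulrA.
split; first exact: mulrA.
by rewrite mulrA centerP; exact/esym/mulrA.
Qed.
Definition center_ctd (z : center Bk) : ctd (restr_bimod f (reg_bimod B)) :=
  Ctd (center_ctd_subproof z).
Fact center_ctd_linear : linear center_ctd.
Proof.
move=> a z z'; apply: ctdP => b; rewrite ctdDE ctdZE.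
rewrite -[LHS]/((alg_map B (f a) * center_val z + center_val z') * (b : B)).
by rewrite mulrDl -mulrA.
Qed.

(** The inverse sends [chi] to [chi 1]. *)
Lemma center_ctd_bij : bijective center_ctd.
Proof.
apply: bijective_inj_surj => [z z' E|chi].
  apply: val_inj; pose ev (c : ctd (restr_bimod f (reg_bimod B))) : B := c (1 : Bk).
  by have := congr1 ev E; rewrite /ev /= !(@mulr1 B).
have chiM (b1 b2 : B) : chi (b1 * b2) = (chi b1 : B) * b2 /\
    chi (b1 * b2) = b1 * (chi b2 : B).
  by case: chi => chi /= /asboolP[_]; apply.
have chiC : (chi (1 : B) : amod Bk) \in center_pred Bk.
  apply/asboolP => b.
  by rewrite -[LHS](chiM 1 b).1 mul1r -[RHS](chiM b 1).2 mulr1.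
exists (Center chiC); apply: ctdP => b /=.
by rewrite -[LHS](chiM 1 b).1 mul1r.
Qed.

Lemma center_ctd_der_iso :
  lmod_iso (der (center_bimod f B)) (der (ctd_bimod f (reg_bimod B))).
Proof.
pose t : {linear center_bimod f B -> ctd_bimod f (reg_bimod B)} :=
  lin center_ctd_linear.
apply: (@der_iso _ _ _ _ t center_ctd_bij) => r z; apply: ctdP => b.
  exact/esym/mulrA.
rewrite -[LHS]/(alg_map B r * center_val z * (b : B)).
by rewrite -[RHS]/(center_val z * (alg_map B r * (b : B))) alg_mapC mulrA.
Qed.

(** The two bimodules have the same underlying data but their module laws have
    different proofs, so they are not convertible. *)
Lemma reg_HH1_iso :
  lmod_iso (HH1 (reg_bimod Bk)) (HH1 (restr_bimod f (reg_bimod B))).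
Proof.
have iL : linear (fun x : reg_bimod Bk => x : restr_bimod f (reg_bimod B)) by [].
by apply: (@HH1_iso _ _ _ _ (lin iL)) => //; exists id.
Qed.

(** A central element [z] defines the [R]-linear centroid element
    [b |-> z b], which is a homothety when [B] is central. *)
Lemma central_der_iso : central B ->
  lmod_iso (der (reg_bimod (com_alg f))) (der (center_bimod f B)).
Proof.
move=> B_central.
have sC (r : R) : (alg_map B r : amod Bk) \in center_pred Bk.
  by apply/asboolP => b; exact: (@alg_mapC R B r b).
pose s (r : reg_bimod (com_alg f)) : center_bimod f B := Center (sC r).
have sL : linear s.
  move=> a x y; apply: val_inj => /=.
  rewrite -[LHS]/(alg_map B (f a * (x : R) + (y : R))).
  by rewrite rmorphD rmorphM.
apply: (@der_iso _ _ _ _ (lin sL)) => [|r x|r x]; last 2 first.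
- by apply: val_inj; exact: rmorphM.
- by apply: val_inj; rewrite /= [(_ : R) * r]mulrC; exact: rmorphM.
apply: bijective_inj_surj => [x y /(congr1 (fun z : center Bk => center_val z)) E|z].
  apply: (bij_inj B_central); apply: val_inj; apply: funext => b.
  by rewrite /= /GRing.scale /= /amod_scale; congr (_ * _).
have zP : (fun b : amod B => (center_val z : B) * (b : B) : amod B)
    \in ctd_pred (reg_bimod B).
  apply/asboolP; split=> [r x y|x y].
    rewrite -[RHS]/(alg_map B r * (center_val z * (x : B)) + center_val z * (y : B)).
    rewrite -[r *: x + y]/(alg_map B r * (x : B) + (y : B)) mulrDr.
    by rewrite mulrA -alg_mapC -mulrA.
  split; first exact: mulrA.
  by rewrite mulrA centerP; exact/esym/mulrA.
have [h _ hK] := B_central; exists (h (Ctd zP)); apply: val_inj.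
have /(congr1 (fun c : ctd (reg_bimod B) => c (1 : B))) /= := hK (Ctd zP).
move=> E; apply: etrans (etrans _ E) _; last exact: (@mulr1 B).
exact/esym/(@mulr1 B).
Qed.
End CenterCentroid.

Section RestrictToBase.
Variables (k R : comPzRingType) (f : {rmorphism k -> R}) (B : algebra R).
Variable N : bimod B.
Local Notation Nk := (restr_bimod f N).
Local Notation Bk := (restr_alg f B).

(** Compare the Leibniz rule for [r b] and for [b r]. *)
Lemma der_central (d : der Nk) (b : B) r :
  lact b (d (alg_map B r) : N) = ract (d (alg_map B r) : N) b.
Proof.
have := derM d (alg_map B r) b; rewrite [X in d X](@alg_mapC R B r b) derM.
rewrite -[lact (alg_map B r : Bk) _]/(lact (alg_map B r) (d b : N)) lact_scal.
rewrite -[ract _ (alg_map B r : Bk)]/(ract (d b : N) (alg_map B r)) ract_scal.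
by rewrite [RHS]addrC => /addrI.
Qed.

Lemma base_ctd_subproof (d : der Nk) (r : R) :
  (fun b : amod Bk => ract (d (alg_map B r) : N) (b : B) : restr f N)
    \in ctd_pred Nk.
Proof.
apply/asboolP; split=> [z x y|x y].
  rewrite -[z *: x + y]/(alg_map B (f z) * (x : B) + (y : B)) ractDr.
  by congr (_ + _); exact: rmapZ.
split; first exact: ractA.
rewrite -[RHS]/(lact (x : B) (ract (d (alg_map B r) : N) (y : B))) -lractA der_central.
exact: ractA.
Qed.
Definition base_ctd (d : der Nk) (r : R) : ctd Nk := Ctd (base_ctd_subproof d r).

Fact base_der_subproof (d : der Nk) : is_der (ctd_bimod f N) (base_ctd d).
Proof.
split=> [z x y|x y]; apply: ctdP => b.
  rewrite ctdDE ctdZE; apply: etrans (_ : ract (d _ : N) b = _) _ => //.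
  rewrite -[z *: x + y]/(f z * (x : R) + (y : R)) rmorphD rmorphM.
  rewrite [d _](derD d (alg_map B (f z) * alg_map B x) (alg_map B y)).
  rewrite [X in ract X _](_ : _ = f z *: (d (alg_map B x) : N) + d (alg_map B y)).
    by rewrite ractDl ractZ.
  by congr (_ + _); exact: (derZ d z).
rewrite ctdDE -[LHS]/(ract (d (alg_map B (x * y)) : N) (b : B)) rmorphM.
rewrite [d _]derM [LHS]ractDl; congr (_ + _).
  exact/esym/ractA.
rewrite -[lact _ _]/(lact (alg_map B x) (d (alg_map B y) : N)) lact_scal.
exact: (@ractZ R B N b x (d (alg_map B y))).
Qed.
Definition base_der (d : der Nk) : der (ctd_bimod f N) :=
  mkder (base_der_subproof d).

Fact base_der_linear : linear base_der.
Proof.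
move=> z d d'; apply: derP => r; apply: ctdP => b.
rewrite derDE derZE ctdDE ctdZE.
rewrite -[LHS]/(ract ((z *: d + d') (alg_map B r) : N) (b : B)) derDE derZE.
by rewrite [LHS]ractDl; congr (_ + _); exact: ractZ.
Qed.

Hypothesis N_inner : forall d : amod B -> N, is_der N d -> is_inner N d.

(** [base_der d] vanishes exactly when [d] vanishes on [R 1], that is, when [d]
    is [R]-linear; and the [R]-linear derivations are the inner ones. *)
Lemma base_der_eq0 (d : der Nk) : base_der d = 0 <-> is_inner Nk d.
Proof.
split=> [E|[n nE]]; last first.
  apply: derP => r; apply: ctdP => b; rewrite der0E.
  have c0 : (0 : ctd Nk) b = 0.
    by apply: (addrI ((0 : ctd Nk) b)); rewrite -ctdDE !addr0.
  rewrite [RHS]c0 -[LHS]/(ract (d (alg_map B r) : N) (b : B)).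
  rewrite [d _]nE -[lact _ _]/(lact (alg_map B r) (n : N)) lact_scal.
  rewrite -[ract n _]/(ract (n : N) (alg_map B r)) ract_scal subrr.
  exact: ract0.
have dR r : d (alg_map B r) = 0.
  have := congr1 (fun e : der (ctd_bimod f N) => e r (1 : Bk)) E.
  rewrite der0E.
  have -> : (0 : ctd Nk) 1 = 0.
    by apply: (addrI ((0 : ctd Nk) 1)); rewrite -ctdDE !addr0.
  by rewrite -[LHS]/(ract (d (alg_map B r) : N) (1 : B)) [ract _ _]rmap1.
apply: (N_inner (d := d)); split=> [r x y|x y]; last exact: (derM d x y).
rewrite -[r *: x + y]/(alg_map B r * (x : B) + (y : B)).
rewrite [LHS](derD d (alg_map B r * (x : B))) [d (_ * _)]derM dR ract0 add0r.
by congr (_ + _); exact: lact_scal.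
Qed.

Hypothesis N_extend : forall D : R -> N,
    derivation idfun D -> (forall z, D (f z) = 0) ->
    (forall (b : B) r, lact b (D r) = ract (D r) b) ->
  exists d : B -> N,
    [/\ forall b b', d (b + b') = d b + d b',
        forall b b', d (b * b') = ract (d b) b' + lact b (d b') &
        forall r, d (alg_map B r) = D r].

(** The derivation [r |-> e(r)(1)] of [R] has values commuting with [B], and any
    extension of it to [B] is sent to [e], since [e(r)(b) = e(r)(1) b]. *)
Lemma base_der_surj (e : der (ctd_bimod f N)) : exists d, base_der d = e.
Proof.
have chiM (chi : ctd Nk) (b1 b2 : B) : (chi (b1 * b2) : N) = ract (chi b1 : N) b2 /\
    (chi (b1 * b2) : N) = lact b1 (chi b2 : N).
  by case: chi => chi /= /asboolP[_]; apply.
pose ev r : N := e r (1 : B).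
have evC (b : B) r : lact b (ev r) = ract (ev r) b.
  by rewrite -(chiM _ b 1).2 -(chiM _ 1 b).1 mulr1 mul1r.
have ev_der : derivation idfun ev.
  split=> r r'; rewrite /ev; first by rewrite [e _]derD [LHS]ctdDE.
  rewrite [e _]derM ctdDE addrC; congr (_ + _).
  rewrite -[LHS]/(e r (alg_map B r' * 1) : N).
  by rewrite [LHS](chiM _ (alg_map B r') 1).2 lact_scal.
have ev_k z : ev (f z) = 0.
  have e0 : e (f z : R) = 0.
    have : e (f z * 1 : R) = z *: e (1 : R) := derZ e z (1 : R).
    by rewrite mulr1 [e 1]der1 scaler0.
  by rewrite /ev e0; apply: (addrI ((0 : ctd Nk) (1 : B))); rewrite -ctdDE !addr0.
have [d [dD dM dE]] := N_extend ev_der ev_k evC.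
have d_der : is_der Nk d.
  split=> [z x y|x y]; last exact: dM.
  rewrite -[z *: x + y]/(alg_map B (f z) * (x : B) + (y : B)) dD dM dE ev_k.
  by rewrite [ract _ _]ract0 add0r; congr (_ + _); exact: lact_scal.
exists (mkder d_der); apply: derP => r; apply: ctdP => b.
rewrite -[LHS]/(ract (d (alg_map B r)) (b : B)) dE /ev.
by rewrite -(chiM _ 1 b).1 mul1r.
Qed.

Lemma HH1_base_iso : lmod_iso (HH1 Nk) (der (ctd_bimod f N)).
Proof.
apply: (lquot_iso _ (h := lin base_der_linear)) => [e|d]; rewrite ?linE.
  exact: base_der_surj.
by rewrite base_der_eq0; split=> /asboolP.
Qed.
End RestrictToBase.

Theorem mainTheorem2 (k R S : comPzRingType)
    (f : {rmorphism k -> R}) (g : {rmorphism R -> S})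
    (A : algebra k) (B : subalgebra (AS_R f g A)) :
  separable A ->
  perfect A -> fp_module (amod A) ->
  flat (amod (com_alg f)) ->
  etale g -> faithfully_flat (amod (com_alg g)) ->
  is_form B ->
  (forall N : bimod B, has_bimod_map g N ->
     (forall d : amod B -> N, is_der N d <-> is_inner N d) /\
     lmod_iso (HH1 (restr_bimod f N)) (der (ctd_bimod f N))) /\
  (exists phi : {linear center (restr_alg f B) ->
                        ctd (restr_bimod f (reg_bimod B))},
     bijective phi /\
     forall (z : center (restr_alg f B)) (b : B),
       phi z b = (center_val z : B) * b) /\
  (has_bimod_map g (reg_bimod B) ->
     lmod_iso (HH1 (reg_bimod (restr_alg f B))) (der (center_bimod f B)) /\
     (central B ->
        lmod_iso (HH1 (reg_bimod (restr_alg f B)))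
                 (der (reg_bimod (com_alg f))))).
Proof.
move=> A_sep _ A_fp _ [_ gE] gF B_form.
have B_inner (N : bimod B) (d : amod B -> N) : is_der N d -> is_inner N d.
  exact: form_inner B_form gF A_fp A_sep N d.
have B_HH1 (N : bimod B) : lmod_iso (HH1 (restr_bimod f N)) (der (ctd_bimod f N)).
  apply: HH1_base_iso (@B_inner N) _ => D.
  exact: (form_extend_derivation B_form A_fp gF gE).
have B_center : lmod_iso (HH1 (reg_bimod (restr_alg f B))) (der (center_bimod f B)).
  apply: lmod_iso_trans (reg_HH1_iso f B) _.
  exact: lmod_iso_trans (B_HH1 _) (lmod_iso_sym (center_ctd_der_iso f B)).
split; [|split].
- by move=> N _; split=> // d; split; [exact: B_inner | exact: inner_is_der].
- by exists (lin (@center_ctd_linear _ _ f B)); split=> //; exact: center_ctd_bij.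
move=> _; split=> // B_central; apply: lmod_iso_trans B_center _.
exact: lmod_iso_sym (central_der_iso f B_central).
Qed.
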